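(* Let $(A,\Delta,\kappa,\epsilon)$ be any $C^*$-quantum groupoid whose Cartan subalgebras are not abelian. Then it can be deformed in such a way that the antipode becomes non-involutive on the Cartan subalgebras: there is an admissible element $k\in A_t$ such that the deformation $(A_k,\Delta_k,\kappa_k,\epsilon_k)$ is a $C^*$-quantum groupoid for which $\kappa_k^2$ is not the identity on its Cartan subalgebras. Moreover, there are uncountably many pairwise non-isomorphic $C^*$-quantum groupoids having the same underlying algebra structure as $A$.
   Context: A $C^*$-quantum groupoid (weak Hopf $C^*$-algebra) is a collection $(A,\Delta,\kappa,\epsilon)$ where: $A$ is a finite-dimensional (unital) $C^*$-algebra; $\Delta:A\to A\otimes A$ is a $*$-homomorphism, not necessarily unital, with $(\Delta\otimes i)\Delta=(i\otimes\Delta)\Delta$ ($i$ = identity map); $\kappa:A\to A$ (antipode) is linear with $(\kappa\circ * )^2=i$, $\kappa(xy)=\kappa(y)\kappa(x)$ for all $x,y\in A$, $(\kappa\otimes\kappa)\Delta=\varsigma\Delta\kappa$ ($\varsigma$ the flip on $A\otimes A$), and $(m(\kappa\otimes i)\otimes i)(\Delta\otimes i)\Delta(x)=(1\otimes x)\Delta(1)$ for all $x\in A$, where $m(a\otimes b)=ab$; $\epsilon$ (counit) is a positive linear form on $A$ with $(\epsilon\otimes i)\Delta=(i\otimes\epsilon)\Delta=i$ and $(\epsilon\otimes\epsilon)((x\otimes 1)\Delta(1)(1\otimes y))=\epsilon(xy)$ for all $x,y\in A$. The target and source Cartan subalgebras are the $C^*$-subalgebras $A_t=\{x\in A:\Delta(x)=\Delta(1)(x\otimes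 1)=(x\otimes 1)\Delta(1)\}$ and $A_s=\{x\in A:\Delta(x)=\Delta(1)(1\otimes x)=(1\otimes x)\Delta(1)\}$. The antipode restricts to an anti-isomorphism of algebras between them, so one is abelian if and only if the other is, and $\kappa^2$ is the identity on one if and only if it is the identity on the other. ''Same underlying algebra structure'' refers to the complex algebra $A$ only; the involution is allowed to differ. An isomorphism of $C^*$-quantum groupoids is a $*$-algebra isomorphism compatible with the coproducts, antipodes and counits. For a finite-dimensional $C^*$-algebra $N\cong\bigoplus_\gamma M_{n_\gamma}(\mathbb C)$ with a system of matrix units $\{e^\gamma_{i,j}:1\le i,j\le n_\gamma\}$, $E_{Z(N)}:N\to Z(N)$ is the canonical conditional expectation onto the center, $E_{Z(N)}(n)=\sum_{\gamma,i,j}\frac1{n_\gamma}e^\gamma_{i,j}\,n\,e^\gamma_{j,i}$. The canonical element of $(A,\Delta,\kappa,\epsilon)$ is the unique invertible element $q\in A_t$ such that, for any system of matrix units $(e^\gamma_{i,j})$ of $A_t\cong\bigoplus_\gamma M_{n_\gamma}(\mathbb C)$, $\Delta(1)=\sum_\gamma\sum_{i,j}\frac1{n_\gamma}\kappa^{-1}(e^\gamma_{i,j}q)\otimes e^\gamma_{j,i}$; such an element exists, is positive, and satisfies $\kappa^2(q)=q$, $E_{Z(A_t)}(q)=1$, and $\kappa^2(x)=q^{-1}\kappa(q)xq\kappa(q^{-1})$ for all $x$ in the algebra generated by $A_t$ and $A_s$. Call $k\in A_t$ admissible if it is positive and invertible, $\kappa^2(k)=k$, and $E_{Z(A_t)}(k^{-1}q)=1$.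 The deformation of $(A,\Delta,\kappa,\epsilon)$ by an admissible $k$ is $(A_k,\Delta_k,\kappa_k,\epsilon_k)$, where $A_k$ is the algebra $A$ with involution $a^{*_k}=ka^*k^{-1}$, and $\Delta_k(a)=\Delta(a)(1\otimes k^{-1})$, $\kappa_k(a)=k\kappa(a)k^{-1}$, $\epsilon_k(a)=\epsilon(ak)$ for $a\in A$. *)

(* Defs.v *)
From HB Require Import structures.
From mathcomp Require Import all_boot all_order all_algebra all_field.
From mathcomp Require Import complex.
From mathcomp Require Import all_classical all_reals.

Set Implicit Arguments.
Unset Strict Implicit.
Unset Printing Implicit Defensive.

Import Order.TTheory GRing.Theory Num.Theory.
Local Open Scope ring_scope.

(* Tensor products of finite-dimensional spaces, encoded by the coordinates
   in the basis (a_i (x) b_j) attached to fixed bases of the two factors.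
   Lemmas [tens_bilinear], [tlift_tens] and [tensor_lin] state the universal
   property, so that the choice of bases plays no role.  For algebras, the product put on
   [tensor A B] is that of [tens_mul], not the product of matrices. *)

Definition tensor (F : fieldType) (A B : vectType F) : Type :=
  'M[F]_(\dim {:A}, \dim {:B}).

HB.instance Definition _ (F : fieldType) (A B : vectType F) :=
  Vector.copy (tensor A B) 'M[F]_(\dim {:A}, \dim {:B}).

Definition tcoef (F : fieldType) (A B : vectType F) (t : tensor A B)
    (i : 'I_(\dim {:A})) (j : 'I_(\dim {:B})) : F :=
  fun_of_matrix t i j.

Definition tens (F : fieldType) (A B : vectType F) (a : A) (b : B) :
    tensor A B :=
  \matrix_(i, j) (coord (vbasis {:A}) i a * coord (vbasis {:B}) j b).

Notation "a ⊗ b" := (tens a b) (at level 40, left associativity) : ring_scope.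

Definition tlift (F : fieldType) (A B : vectType F) (V : lmodType F)
    (f : A -> B -> V) (t : tensor A B) : V :=
  \sum_i \sum_j tcoef t i j *: f (vbasis {:A})`_i (vbasis {:B})`_j.

Definition bilin (F : fieldType) (A B V : lmodType F) (f : A -> B -> V) :=
  (forall b, linear (f^~ b)) /\ (forall a, linear (f a)).

Section TensorTheory.
Context (F : fieldType).
Implicit Types A B : vectType F.

Lemma tlift_linear A B (V : lmodType F) (f : A -> B -> V) : linear (tlift f).
Proof.
move=> c s t; rewrite /tlift scaler_sumr -big_split; apply: eq_bigr => i _ /=.
rewrite scaler_sumr -big_split; apply: eq_bigr => j _ /=.
by rewrite /tcoef !mxE scalerDl scalerA.
Qed.

HB.instance Definition _ A B (V : lmodType F) (f : A -> B -> V) :=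
  GRing.isLinear.Build F (tensor A B) V _ (tlift f) (tlift_linear f).

Lemma tlift_fun_linear A B (V : lmodType F) (f g h : A -> B -> V) c t :
  (forall a b, h a b = c *: f a b + g a b) ->
  tlift h t = c *: tlift f t + tlift g t.
Proof.
move=> hE; rewrite /tlift scaler_sumr -big_split; apply: eq_bigr => i _ /=.
rewrite scaler_sumr -big_split; apply: eq_bigr => j _ /=.
by rewrite hE scalerDr !scalerA mulrC.
Qed.

Lemma tens_bilinear A B : bilin (@tens F A B).
Proof.
split=> [b c a a'|a c b b']; apply/matrixP=> i j; rewrite !mxE linearP /=.
  by rewrite mulrDl mulrA.
by rewrite mulrDr mulrCA.
Qed.

Lemma tlift_tens A B (V : lmodType F) (f : A -> B -> V) a b :
  bilin f -> tlift f (a ⊗ b) = f a b.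
Proof.
case=> fl fr.
pose L y := GRing.isLinear.Build F A V _ (f^~ y) (fl y).
pose L' y : {linear A -> V} := HB.pack (f^~ y) (L y).
pose M x := GRing.isLinear.Build F B V _ (f x) (fr x).
pose M' x : {linear B -> V} := HB.pack (f x) (M x).
rewrite {2}(coord_vbasis (memvf a)) -[f _ b]/(L' b _) linear_sum /tlift.
apply: eq_bigr => i _; rewrite linearZ /=.
rewrite {2}(coord_vbasis (memvf b)) -[f _ (\sum_i _)]/(M' _ _) linear_sum.
rewrite scaler_sumr; apply: eq_bigr => j _; rewrite linearZ /= scalerA.
by rewrite /tcoef mxE.
Qed.

Lemma tlift_id A B (t : tensor A B) : tlift (@tens F A B) t = t.
Proof.
apply/matrixP=> i j; rewrite /tlift summxE (bigD1 i) //= summxE (bigD1 j) //=.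
have bE (V : vectType F) (k l : 'I_(\dim {:V})) :
    coord (vbasis {:V}) k (vbasis {:V})`_l = (l == k)%:R.
  by apply: coord_free; apply: basis_free (vbasisP _).
rewrite !mxE !bE !eqxx !mulr1 !big1 ?addr0 // => [i' ii'|j' jj'].
  rewrite summxE big1 // => j' _.
  by rewrite !mxE !bE (negPf ii') mul0r mulr0.
by rewrite !mxE !bE (negPf jj') !mulr0.
Qed.

Lemma tensor_lin A B (V : lmodType F) (f g : {linear tensor A B -> V}) :
  (forall a b, f (a ⊗ b) = g (a ⊗ b)) -> f =1 g.
Proof.
move=> fg t; rewrite -(tlift_id t) /tlift !linear_sum; apply: eq_bigr => i _.
by rewrite !linear_sum; apply: eq_bigr => j _; rewrite !linearZ /= fg.
Qed.

End TensorTheory.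

Section TensorAlgebra.
Context (F : fieldType) (A B : falgType F).
Implicit Types s t u : tensor A B.

Definition tmul s t : tensor A B :=
  tlift (fun a b => tlift (fun c d => (a * c) ⊗ (b * d)) t) s.

Fact tmul_bilin : bilin tmul.
Proof.
split=> [t c s s'|s c t t']; first exact: tlift_linear.
by apply: tlift_fun_linear => a b; apply: tlift_linear.
Qed.

Lemma tmulE a b c d : tmul (a ⊗ b) (c ⊗ d) = (a * c) ⊗ (b * d).
Proof.
have [tl tr] := tens_bilinear A B.
rewrite /tmul tlift_tens ?tlift_tens //; split=> [y k x x'|x k y y'];
  try (apply: tlift_fun_linear => c' d');
  by rewrite (mulrDl, mulrDr) -(scalerAl, scalerAr) (tl, tr).
Qed.

Let tmulL t : linear (tmul^~ t). Proof. by case: tmul_bilin. Qed.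
Let tmulR s : linear (tmul s). Proof. by case: tmul_bilin. Qed.
HB.instance Definition _ s :=
  GRing.isLinear.Build F (tensor A B) (tensor A B) _ (tmul s) (tmulR s).
Definition tmull t s := tmul s t.
HB.instance Definition _ t :=
  GRing.isLinear.Build F (tensor A B) (tensor A B) _ (tmull t) (tmulL t).

Fact tmulA : associative tmul.
Proof.
move=> s t u.
pose f1 := [the {linear _ -> _} of tmull (tmul t u)].
pose g1 := [the {linear _ -> _} of tmull u \o tmull t].
apply: (tensor_lin (f := f1) (g := g1)) => a b.
pose f2 := [the {linear _ -> _} of tmul (a ⊗ b) \o tmull u].
pose g2 := [the {linear _ -> _} of tmull u \o tmul (a ⊗ b)].
apply: (tensor_lin (f := f2) (g := g2)) => c d.
pose f3 := [the {linear _ -> _} of tmul (a ⊗ b) \o tmul (c ⊗ d)].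
pose g3 := [the {linear _ -> _} of tmul (tmul (a ⊗ b) (c ⊗ d))].
apply: (tensor_lin (f := f3) (g := g3)) => e f.
by rewrite /f3 /g3 /= !tmulE !mulrA.
Qed.

Fact tmul1l : left_id (1 ⊗ 1) tmul.
Proof.
apply: (tensor_lin (f := [the {linear _ -> _} of tmul (1 ⊗ 1)])
  (g := [the {linear _ -> _} of idfun])) => a b.
by rewrite /= tmulE !mul1r.
Qed.

Fact tmul1r : right_id (1 ⊗ 1) tmul.
Proof.
apply: (tensor_lin (f := [the {linear _ -> _} of tmull (1 ⊗ 1)])
  (g := [the {linear _ -> _} of idfun])) => a b.
by rewrite /= /tmull tmulE !mulr1.
Qed.

Fact tmulDl : left_distributive tmul +%R.
Proof. by move=> s t u; have := tmulL u 1 s t; rewrite !scale1r. Qed.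

Fact tmulDr : right_distributive tmul +%R.
Proof. by move=> s t u; rewrite linearD. Qed.

Fact tone_neq0 : 1 ⊗ 1 != 0 :> tensor A B.
Proof.
have nz (E : falgType F) : exists i, coord (vbasis {:E}) i 1 != 0.
  apply/existsP; apply: contraNT (oner_neq0 E); rewrite negb_exists.
  move/forallP => E0; rewrite (coord_vbasis (memvf (1 : E))) big1 // => i _.
  by move: (E0 i); rewrite negbK => /eqP->; rewrite scale0r.
have [[i Hi] [j Hj]] := (nz A, nz B).
apply/eqP => /matrixP/(_ i j); rewrite !mxE => /eqP.
by rewrite mulf_eq0 (negPf Hi) (negPf Hj).
Qed.

HB.instance Definition _ := GRing.Zmodule_isNzRing.Build (tensor A B)
  tmulA tmul1l tmul1r tmulDl tmulDr tone_neq0.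

Fact tensor_scaleAl (k : F) s t : k *: (s * t) = k *: s * t.
Proof. by rewrite -[RHS]/(tmull t (k *: s)) linearZ. Qed.

HB.instance Definition _ :=
  GRing.Lmodule_isLalgebra.Build F (tensor A B) tensor_scaleAl.

Fact tensor_scaleAr (k : F) s t : k *: (s * t) = s * (k *: t).
Proof. by rewrite -[RHS]/(tmul s (k *: t)) linearZ. Qed.

HB.instance Definition _ :=
  GRing.Lalgebra_isAlgebra.Build F (tensor A B) tensor_scaleAr.

HB.instance Definition _ := Algebra_isFalgebra.Build F (tensor A B).

Lemma tens_mul (a c : A) (b d : B) : (a ⊗ b) * (c ⊗ d) = (a * c) ⊗ (b * d).
Proof. exact: tmulE. Qed.

End TensorAlgebra.

Definition tensor_map (F : fieldType) (A B A' B' : vectType F)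
    (f : A -> A') (g : B -> B') : tensor A B -> tensor A' B' :=
  tlift (fun a b => f a ⊗ g b).

Definition tensor_flip (F : fieldType) (A B : vectType F) :
    tensor A B -> tensor B A :=
  tlift (fun a b => b ⊗ a).

Definition tensor_assoc (F : fieldType) (A B D : vectType F) :
    tensor (tensor A B) D -> tensor A (tensor B D) :=
  tlift (fun s d => tlift (fun a b => a ⊗ (b ⊗ d)) s).

Definition semilinear_conj (R : realType) (V W : lmodType R[i]) (f : V -> W) :=
  forall (c : R[i]) x y, f (c *: x + y) = c^* *: f x + f y.

(* The conjugate-linear extension of [a ⊗ b |-> f a ⊗ g b], for conjugate
   linear [f] and [g]; used for the involution of a tensor product. *)
Definition tensor_map_conj (R : realType) (A B A' B' : vectType R[i])
    (f : A -> A') (g : B -> B') (t : tensor A B) : tensor A' B' :=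
  \sum_i \sum_j (tcoef t i j)^* *: (f (vbasis {:A})`_i ⊗ g (vbasis {:B})`_j).

Lemma tensor_map_conjE (R : realType) (A B A' B' : vectType R[i])
    (f : A -> A') (g : B -> B') a b :
  semilinear_conj f -> semilinear_conj g ->
  tensor_map_conj f g (a ⊗ b) = f a ⊗ g b.
Proof.
have ext (V W : vectType R[i]) (h : V -> W) v : semilinear_conj h ->
    h v = \sum_i (coord (vbasis {:V}) i v)^* *: h (vbasis {:V})`_i.
  move=> hc; have h0 : h 0 = 0.
    by have := hc (-1) 0 0; rewrite rmorphN1 scaler0 addr0 scaleN1r addNr.
  rewrite {1}(coord_vbasis (memvf v)).
  elim/big_rec2: _ => [|i y x _ <-]; first exact: h0.
  exact: hc.
move=> fc gc; have [tl tr] := tens_bilinear A' B'.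
rewrite (ext _ _ f a fc) (ext _ _ g b gc).
pose L y : {linear A' -> tensor A' B'} :=
  HB.pack (@tens _ A' B' ^~ y) (GRing.isLinear.Build _ _ _ _ _ (tl y)).
pose M x : {linear B' -> tensor A' B'} :=
  HB.pack (@tens _ A' B' x) (GRing.isLinear.Build _ _ _ _ _ (tr x)).
rewrite -[RHS]/(L _ _) linear_sum; apply: eq_bigr => i _.
rewrite linearZ /= -[X in _ *: X]/(M _ _) linear_sum scaler_sumr.
apply: eq_bigr => j _; rewrite linearZ /= scalerA.
by rewrite /tcoef mxE rmorphM.
Qed.

Definition is_involution (R : realType) (A : falgType R[i]) (star : A -> A) :=
  [/\ semilinear_conj star,
      involutive star &
      forall x y, star (x * y) = star y * star x].

(* No completeness clause: every norm on [A] is complete, as [A] is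
   finite-dimensional. *)
Definition is_cstar_norm (R : realType) (A : falgType R[i]) (star : A -> A)
    (N : A -> R) :=
  [/\ forall x, 0 <= N x /\ (N x = 0 -> x = 0),
      forall x y, N (x + y) <= N x + N y,
      forall (c : R[i]) x, (N (c *: x))%:C%C = `|c| * (N x)%:C%C,
      forall x y, N (x * y) <= N x * N y &
      forall x, N (star x * x) = N x ^+ 2].

Definition is_cstar_algebra (R : realType) (A : falgType R[i])
    (star : A -> A) :=
  is_involution star /\ exists N, is_cstar_norm star N.

(* The structure maps are bare functions, and the involution is part of the
   data: several structures on one complex algebra [A] have to be compared. *)
Record groupoid_data (R : realType) (A : falgType R[i]) := GroupoidData {
  star : A -> A;
  Delta : A -> tensor A A;
  kappa : A -> A;
  eps : A -> R[i] }.

Section QuantumGroupoid.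
Context (R : realType) (A : falgType R[i]).
Implicit Types G : groupoid_data A.

Definition is_coproduct G :=
  let: GroupoidData st D ka ep := G in
  [/\ linear D,
      forall x y, D (x * y) = D x * D y,
      forall x, D (st x) = tensor_map_conj st st (D x) &
      forall x, tensor_assoc (tensor_map D idfun (D x))
                = tensor_map idfun D (D x)].

Definition is_antipode G :=
  let: GroupoidData st D ka ep := G in
  [/\ linear ka,
      involutive (ka \o st),
      forall x y, ka (x * y) = ka y * ka x,
      forall x, tensor_map ka ka (D x) = tensor_flip (D (ka x)) &
      forall x,
        tensor_map (tlift (fun a b => ka a * b)) idfun
          (tensor_map D idfun (D x))
        = (1 ⊗ x) * D 1].

Definition is_counit G :=
  let: GroupoidData st D ka ep := G in
  [/\ scalar ep,
      forall x, 0 <= ep (st x * x),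
      forall x, tlift (fun a b => ep a *: b) (D x) = x
                /\ tlift (fun a b => ep b *: a) (D x) = x &
      forall x y,
        tlift (fun a b => ep a * ep b : R[i]^o)
          ((x ⊗ 1) * D 1 * (1 ⊗ y))
        = ep (x * y)].

Definition is_quantum_groupoid G :=
  [/\ is_cstar_algebra (star G), is_coproduct G, is_antipode G &
      is_counit G].

Definition target G : {pred A} := fun x =>
  (Delta G x == Delta G 1 * (x ⊗ 1)) && (Delta G x == (x ⊗ 1) * Delta G 1).

Definition source G : {pred A} := fun x =>
  (Delta G x == Delta G 1 * (1 ⊗ x)) && (Delta G x == (1 ⊗ x) * Delta G 1).

Definition abelian_subalg (N : {pred A}) :=
  {in N &, forall x y, x * y = y * x}.

Definition is_positive G x := exists y, x = star G y * y.

End QuantumGroupoid.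

Record matrix_family (A : Type) := MatrixFamily {
  blocks : nat;
  bsize : 'I_blocks -> nat;
  munit : forall g, 'I_(bsize g) -> 'I_(bsize g) -> A }.
Arguments bsize {A} _ _.
Arguments munit {A} _ _ _ _.

Section Deformation.
Context (R : realType) (A : falgType R[i]).
Implicit Types (G : groupoid_data A) (e : matrix_family A).

(* A system of matrix units of a unital *-subalgebra [N]; linear independence
   follows from the relations and from [munit e g i j != 0]. *)
Definition is_matrix_units G (N : {pred A}) e :=
  [/\ forall g, (0 < bsize e g)%N,
      forall g i j, [/\ munit e g i j \in N, munit e g i j != 0 &
                        star G (munit e g i j) = munit e g j i],
      forall g i j k l, munit e g i j * munit e g k l
                        = if j == k then munit e g i l else 0,
      forall g h i j k l, g != h -> munit e g i j * munit e h k l = 0 &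
      \sum_g \sum_i munit e g i i = 1 /\
      {in N, forall x, exists c : forall g, 'I_(bsize e g) -> 'I_(bsize e g)
                                            -> R[i],
        x = \sum_g \sum_i \sum_j c g i j *: munit e g i j}].

Definition center_expectation e (n : A) : A :=
  \sum_g \sum_i \sum_j
    (bsize e g)%:R^-1 *: (munit e g i j * n * munit e g j i).

(* [(linfun (kappa G))^-1] is the inverse of the antipode, which is linear
   and bijective as soon as [is_antipode G]. *)
Definition is_canonical_element G (q : A) :=
  [/\ q \in target G, q \is a GRing.unit &
      forall e, is_matrix_units G (target G) e ->
        Delta G 1 = \sum_g \sum_i \sum_j (bsize e g)%:R^-1 *:
          ((linfun (kappa G))^-1%VF (munit e g i j * q) ⊗ munit e g j i)].

Definition admissible G (k : A) :=
  [/\ k \in target G, is_positive G k, k \is a GRing.unit,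
      kappa G (kappa G k) = k &
      exists2 q, is_canonical_element G q &
        forall e, is_matrix_units G (target G) e ->
          center_expectation e (k^-1 * q) = 1].

Definition deformation G (k : A) : groupoid_data A :=
  {| star := fun a => k * star G a * k^-1;
     Delta := fun a => Delta G a * (1 ⊗ k^-1);
     kappa := fun a => k * kappa G a * k^-1;
     eps := fun a => eps G (a * k) |}.

End Deformation.

Definition groupoid_iso (R : realType) (A B : falgType R[i])
    (G : groupoid_data A) (H : groupoid_data B) :=
  exists phi : A -> B,
    [/\ [/\ linear phi, bijective phi, phi 1 = 1 &
             forall x y, phi (x * y) = phi x * phi y],
        forall x, phi (star G x) = star H (phi x),
        forall x, tensor_map phi phi (Delta G x) = Delta H (phi x),
        forall x, phi (kappa G x) = kappa H (phi x) &
        forall x, eps H (phi x) = eps G x].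

(* Main.v *)
From HB Require Import structures.
Require Import Defs.
From mathcomp Require Import all_boot all_order all_algebra all_field.
From mathcomp Require Import complex ring.
From mathcomp Require Import all_classical all_reals.
From mathcomp Require Import lebesgue_measure.

Set Implicit Arguments.
Unset Strict Implicit.
Unset Printing Implicit Defensive.

Import Order.TTheory GRing.Theory Num.Theory.
Local Open Scope ring_scope.

(** Write [A_t] for the target algebra and [b = (kappa ⊗ i) Delta(1)].

    The antipode axiom, together with the involution, shows that [Delta(1)] has
    its left legs in the source algebra, so that the left legs of [b] are in
    [A_t], and that [b (kappa^2 z ⊗ 1) = (1 ⊗ z) b] and
    [(z ⊗ 1) b = b (1 ⊗ z)] for [z] in [A_t] ([kunit_twist], [kunit_comm]).
    The counit axioms make [b] the dual tensor of the bilinear form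
    [epsilon(x y)] on [A_t] ([kunit_dual]); hence the positive form [epsilon] is
    faithful there, and the Gram-Schmidt process turns [b] into a sum of
    tensors [f ⊗ f^*] with [f] in [A_t] ([kunit_orthonormal]).

    The canonical element is then [q = sum f^* f].  It is positive by
    construction, it satisfies [q kappa^2(z) = z q], and moving the factors
    [f^*] through the Casimir element of a system of matrix units gives the
    formula that defines it ([canonical_casimir]).

    A deformation by [k] has the axioms of a quantum groupoid as soon as
    [k = y^* y] is an invertible element of [A_t] fixed by [kappa^2] with
    [sum f k^-1 f^* = 1] ([deformation_quantum_groupoid]); this sum is
    the expectation of [q k^-1] onto the center.  On [A_t], the squared antipode
    of the deformation is conjugation by [k q^-1].

    As [A_t] is not abelian, it contains a self-adjoint projection [p] that
    commutes with [q] and is not central ([noncentral_projection]), by the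
    spectral theorem for the faithful form.  For [r > 0], the element
    [k_r = z q (1 + r p)^-1], where [z] is a positive central element that
    normalises the expectation, is admissible, and the squared antipode of its
    deformation is conjugation by [(1 + r p)^-1] on [A_t]
    ([deforming_element]).  Its eigenvalues there are [1], [1 + r] and
    [(1 + r)^-1].  So it is not the identity, and [r] is determined by the
    isomorphism class of the deformation ([iso_parameter]): the deformations by
    the [k_r] are as many as the positive reals. *)

(** * Computing with tensors *)

Section TensorSpaces.
Context (F : fieldType).
Implicit Types A B D V W : vectType F.

Lemma tensDl A B (a a' : A) (b : B) : (a + a') ⊗ b = a ⊗ b + a' ⊗ b.
Proof. by have := (tens_bilinear A B).1 b 1 a a'; rewrite !scale1r. Qed.

Lemma tensDr A B (a : A) (b b' : B) : a ⊗ (b + b') = a ⊗ b + a ⊗ b'.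
Proof. by have := (tens_bilinear A B).2 a 1 b b'; rewrite !scale1r. Qed.

Lemma tens0l A B (b : B) : (0 : A) ⊗ b = 0.
Proof. by apply: (addrI ((0 : A) ⊗ b)); rewrite -tensDl !addr0. Qed.

Lemma tens0r A B (a : A) : a ⊗ (0 : B) = 0.
Proof. by apply: (addrI (a ⊗ (0 : B))); rewrite -tensDr !addr0. Qed.

Lemma tensZl A B (c : F) (a : A) (b : B) : (c *: a) ⊗ b = c *: (a ⊗ b).
Proof. by have := (tens_bilinear A B).1 b c a 0; rewrite tens0l !addr0. Qed.

Lemma tensZr A B (c : F) (a : A) (b : B) : a ⊗ (c *: b) = c *: (a ⊗ b).
Proof. by have := (tens_bilinear A B).2 a c b 0; rewrite tens0r !addr0. Qed.

Lemma tens_suml A B I (r : seq I) (P : pred I) (a : I -> A) (b : B) :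
  (\sum_(i <- r | P i) a i) ⊗ b = \sum_(i <- r | P i) a i ⊗ b.
Proof.
elim/big_rec2: _ => [|i x y _ <-]; first exact: tens0l.
exact: tensDl.
Qed.

Lemma tens_sumr A B I (r : seq I) (P : pred I) (a : A) (b : I -> B) :
  a ⊗ (\sum_(i <- r | P i) b i) = \sum_(i <- r | P i) a ⊗ b i.
Proof.
elim/big_rec2: _ => [|i x y _ <-]; first exact: tens0r.
exact: tensDr.
Qed.

(** Additivity is enough here, as the scalars are absorbed by the left factor
    of a pure tensor. *)
Lemma tens_ind A B (P : tensor A B -> Prop) :
  (forall s t, P s -> P t -> P (s + t)) -> (forall a b, P (a ⊗ b)) ->
  forall t, P t.
Proof.
move=> PD P1 t; rewrite -(tlift_id t) /tlift.
have P0 : P 0 by rewrite -(tens0l A (0 : B)).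
apply: big_ind => // i _; apply: big_ind => // j _.
by rewrite -tensZl.
Qed.

Definition slice A B (f : B -> F) : tensor A B -> A :=
  tlift (fun a b => f b *: a).

HB.instance Definition _ A B (f : B -> F) :=
  GRing.Linear.copy (@slice A B f) (tlift (fun (a : A) (b : B) => f b *: a)).

Lemma sliceE A B (f : {scalar B}) (a : A) b : slice f (a ⊗ b) = f b *: a.
Proof.
rewrite /slice tlift_tens //; split=> [y c x x'|x c y y'].
  by rewrite scalerDr !scalerA mulrC.
by rewrite linearP scalerDl scalerA.
Qed.

HB.instance Definition _ A B A' B' (f : A -> A') (g : B -> B') :=
  GRing.Linear.copy (tensor_map f g)
    (tlift (fun a b => (f a ⊗ g b : tensor A' B'))).
HB.instance Definition _ A B :=
  GRing.Linear.copy (@tensor_flip F A B)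
    (tlift (fun a b => (b ⊗ a : tensor B A))).
HB.instance Definition _ A B D :=
  GRing.Linear.copy (@tensor_assoc F A B D)
    (tlift (fun s d => tlift (fun a b => a ⊗ (b ⊗ d)) s)).

Lemma tensor_mapD A B A' B' (f : A -> A') (g : B -> B') (s t : tensor A B) :
  tensor_map f g (s + t) = tensor_map f g s + tensor_map f g t.
Proof. exact: linearD. Qed.

Lemma tensor_assocD A B D (s t : tensor (tensor A B) D) :
  tensor_assoc (s + t) = tensor_assoc s + tensor_assoc t.
Proof. exact: linearD. Qed.

Lemma tensor_flipD A B (s t : tensor A B) :
  tensor_flip (s + t) = tensor_flip s + tensor_flip t.
Proof. exact: linearD. Qed.

Lemma tensor_map_sum A B A' B' (f : A -> A') (g : B -> B') I (r : seq I)
    (t : I -> tensor A B) :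
  tensor_map f g (\sum_(i <- r) t i) = \sum_(i <- r) tensor_map f g (t i).
Proof. exact: linear_sum. Qed.

Lemma tensor_assoc_sum A B D I (r : seq I) (t : I -> tensor (tensor A B) D) :
  tensor_assoc (\sum_(i <- r) t i) = \sum_(i <- r) tensor_assoc (t i).
Proof. exact: linear_sum. Qed.

Lemma tensor_mapP A B A' B' (f : A -> A') (g : B -> B') a b :
  linear f -> linear g -> tensor_map f g (a ⊗ b) = f a ⊗ g b.
Proof.
move=> fl gl; rewrite /tensor_map tlift_tens //.
have [tl tr] := tens_bilinear A' B'.
by split=> [y c x x'|x c y y']; rewrite (fl, gl) (tl, tr).
Qed.

Lemma tensor_mapE A B A' B' (f : {linear A -> A'}) (g : {linear B -> B'}) a b :
  tensor_map f g (a ⊗ b) = f a ⊗ g b.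
Proof. by apply: tensor_mapP => c x y; rewrite linearP. Qed.

Lemma tensor_flipE A B (a : A) (b : B) : tensor_flip (a ⊗ b) = b ⊗ a.
Proof.
rewrite /tensor_flip tlift_tens //.
by have [tl tr] := tens_bilinear B A; split=> [y c x x'|x c y y'];
  rewrite (tl, tr).
Qed.

Lemma tensor_assocE A B D (a : A) (b : B) (d : D) :
  tensor_assoc (a ⊗ b ⊗ d) = a ⊗ (b ⊗ d).
Proof.
have [l1 r1] := tens_bilinear A (tensor B D).
have [l2 r2] := tens_bilinear B D.
rewrite /tensor_assoc tlift_tens ?tlift_tens //; split=> [y c x x'|x c y y'].
- by rewrite l1.
- by rewrite l2 r1.
- exact: tlift_linear.
- by apply: tlift_fun_linear => a' b'; rewrite r2 r1.
Qed.

Lemma tensor_flipK A B : cancel (@tensor_flip F A B) (@tensor_flip F B A).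
Proof.
elim/tens_ind => [s t IHs IHt|a b]; first by rewrite !linearD /= IHs IHt.
by rewrite !tensor_flipE.
Qed.

(** Expanding the right factor in its basis; the left factors are slices, so
    they are as good as the slices of [t] are. *)
Lemma slice_expand A B (t : tensor A B) :
  t = \sum_i slice (coord (vbasis {:B}) i) t ⊗ (vbasis {:B})`_i.
Proof.
elim/tens_ind: t => [s t {1}-> {1}->|a b].
  by rewrite -big_split; apply: eq_bigr => i _; rewrite linearD /= tensDl.
rewrite {1}(coord_vbasis (memvf b)) tens_sumr; apply: eq_bigr => i _.
by rewrite sliceE tensZl tensZr.
Qed.

Lemma coord_vbasis_delta B (i j : 'I_(\dim {:B})) :
  coord (vbasis {:B}) i (vbasis {:B})`_j = (j == i)%:R.
Proof. by apply: coord_free; apply: basis_free (vbasisP _). Qed.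

Lemma slice_sum A B (x : 'I_(\dim {:B}) -> A) i :
  slice (coord (vbasis {:B}) i) (\sum_j x j ⊗ (vbasis {:B})`_j) = x i.
Proof.
rewrite linear_sum (bigD1 i) //= sliceE /= coord_vbasis_delta eqxx scale1r.
rewrite big1 ?addr0 // => j ji.
by rewrite sliceE /= coord_vbasis_delta (negPf ji) scale0r.
Qed.

(** Triple tensors are compared slice by slice on their last leg, so that the
    two sides of an identity are first brought back to the shape [(_ ⊗ _) ⊗ _]. *)
Lemma tensor_assoc_inj A B D : injective (@tensor_assoc F A B D).
Proof.
pose g : tensor A (tensor B D) -> tensor (tensor A B) D :=
  tlift (fun a => tlift (fun b d => (a ⊗ b ⊗ d : tensor (tensor A B) D))).
have gE a b d : g (a ⊗ (b ⊗ d)) = a ⊗ b ⊗ d.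
  have [l1 r1] := tens_bilinear (tensor A B) D.
  have [l2 r2] := tens_bilinear A B.
  rewrite /g tlift_tens ?tlift_tens //; split=> [y c x x'|x c y y'].
  - by rewrite r2 l1.
  - by rewrite r1.
  - by apply: tlift_fun_linear => a' b'; rewrite l2 l1.
  - exact: tlift_linear.
apply: (can_inj (g := g)); elim/tens_ind => [s t IHs IHt|s d].
  by rewrite linearD /g linearD /= -!/(g _) IHs IHt.
elim/tens_ind: s => [s t IHs IHt|a b]; last by rewrite tensor_assocE gE.
by rewrite tensDl linearD /g linearD /= -!/(g _) IHs IHt.
Qed.

End TensorSpaces.

Section TensorAlgebras.
Context (F : fieldType).
Implicit Types A B D : falgType F.

Lemma tensor_map_mul A B A' B' (f : {linear A -> A'}) (g : {linear B -> B'}) :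
  (forall x y, f (x * y) = f x * f y) -> (forall x y, g (x * y) = g x * g y) ->
  forall s t, tensor_map f g (s * t) = tensor_map f g s * tensor_map f g t.
Proof.
move=> fM gM s t; elim/tens_ind: s => [s s' IH IH'|a b].
  by rewrite mulrDl !linearD /= mulrDl IH IH'.
elim/tens_ind: t => [t t' IH IH'|c d].
  by rewrite mulrDr !linearD /= mulrDr IH IH'.
by rewrite tens_mul !tensor_mapE tens_mul fM gM.
Qed.

Lemma tensor_flip_mul A B (s t : tensor A B) :
  tensor_flip (s * t) = tensor_flip s * tensor_flip t.
Proof.
elim/tens_ind: s => [s s' IH IH'|a b].
  by rewrite mulrDl !linearD /= mulrDl IH IH'.
elim/tens_ind: t => [t t' IH IH'|c d].
  by rewrite mulrDr !linearD /= mulrDr IH IH'.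
by rewrite tens_mul !tensor_flipE tens_mul.
Qed.

Lemma tensor_assoc_mul A B D (s t : tensor (tensor A B) D) :
  tensor_assoc (s * t) = tensor_assoc s * tensor_assoc t.
Proof.
elim/tens_ind: s => [s s' IH IH'|ab d].
  by rewrite mulrDl !linearD /= mulrDl IH IH'.
elim/tens_ind: ab => [s s' IH IH'|a b].
  by rewrite tensDl mulrDl !linearD /= mulrDl IH IH'.
elim/tens_ind: t => [t t' IH IH'|ab' d'].
  by rewrite mulrDr !linearD /= mulrDr IH IH'.
elim/tens_ind: ab' => [s s' IH IH'|a' b'].
  by rewrite tensDl mulrDr !linearD /= mulrDr IH IH'.
by rewrite !tens_mul !tensor_assocE !tens_mul.
Qed.

(** For an antipode [f], the map of the antipode axiom. *)
Definition mul_map A (f : A -> A) : tensor A A -> A :=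
  tlift (fun a b => f a * b).

HB.instance Definition _ A (f : A -> A) :=
  GRing.Linear.copy (mul_map f) (tlift (fun a b => f a * b)).

Lemma mul_mapD A (f : A -> A) s t :
  mul_map f (s + t) = mul_map f s + mul_map f t.
Proof. exact: linearD. Qed.

Lemma mul_mapE A (f : A -> A) a b : linear f -> mul_map f (a ⊗ b) = f a * b.
Proof.
move=> fl; rewrite /mul_map tlift_tens //; split=> [y c x x'|x c y y'].
  by rewrite fl mulrDl scalerAl.
by rewrite mulrDr scalerAr.
Qed.

End TensorAlgebras.

(** * Consequences of the antipode axiom *)

Section Antipode.
Context (F : fieldType) (A : falgType F).
Variables (D : {linear A -> tensor A A}) (ka : {linear A -> A}).
Hypothesis DM : forall x y, D (x * y) = D x * D y.
Hypothesis DA :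
  forall x, tensor_assoc (tensor_map D idfun (D x)) = tensor_map idfun D (D x).
Hypothesis kaM : forall x y, ka (x * y) = ka y * ka x.
Hypothesis ka_mul : forall x,
  tensor_map (mul_map ka) idfun (tensor_map D idfun (D x)) = (1 ⊗ x) * D 1.

(** The antipode axiom only evaluates [(Delta ⊗ i) Delta] after contracting
    two legs.  Applying [i ⊗ Delta] to it and using coassociativity computes
    the iterated coproduct of the unit itself. *)
Lemma weak_unit : tensor_map idfun D (D 1) = (1 ⊗ D 1) * tensor_assoc (D 1 ⊗ 1).
Proof.
pose C (t : tensor A A) : tensor A A :=
  tensor_map (mul_map ka) idfun (tensor_map D idfun t).
pose L t := tensor_map idfun D (C t).
(* [i ⊗ Delta] acts on a leg that the contraction does not touch *)
have step1 t : L t = tensor_map (mul_map ka) idfun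
    (tensor_map D idfun (tensor_map idfun D t)).
  elim/tens_ind: t => [s t IHs IHt|a b]; last by rewrite /L /C !tensor_mapE.
  by rewrite /L /C !tensor_mapD -!/(C _) -!/(L _) IHs IHt.
have step2 (t : tensor (tensor A A) A) :
    tensor_map (mul_map ka) idfun (tensor_map D idfun (tensor_assoc t))
    = tensor_assoc (tensor_map (tensor_map (mul_map ka) idfun) idfun
        (tensor_map (tensor_map D idfun) idfun t)).
  elim/tens_ind: t => [s t IHs IHt|ab d].
    by rewrite !(tensor_mapD, tensor_assocD) IHs IHt.
  elim/tens_ind: ab => [s t IHs IHt|a b].
    by rewrite tensDl !(tensor_mapD, tensor_assocD) IHs IHt.
  rewrite !(tensor_assocE, tensor_mapE) /= !tensor_mapE /=.
  elim/tens_ind: (D a) => [s t IHs IHt|a1 a2].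
    by rewrite !(tensor_mapD, tensDl, tensor_assocD, mul_mapD) IHs IHt.
  by rewrite !(tensor_mapE, tensor_assocE).
(* after regrouping, the antipode axiom applies to the first leg *)
have step3 t : tensor_assoc (tensor_map (tensor_map (mul_map ka) idfun) idfun
        (tensor_map (tensor_map D idfun) idfun (tensor_map D idfun t)))
    = (1 ⊗ t) * tensor_assoc (D 1 ⊗ 1).
  elim/tens_ind: t => [s t IHs IHt|a b].
    by rewrite tensDr !(tensor_mapD, tensor_assocD) IHs IHt mulrDl.
  rewrite !tensor_mapE /= ka_mul.
  elim/tens_ind: (D 1) => [s t IHs IHt|u v].
    by rewrite mulrDr !tensDl !tensor_assocD IHs IHt mulrDr.
  by rewrite tens_mul !tensor_assocE !tens_mul !mulr1 mul1r.
have <- : L (D 1) = tensor_map idfun D (D 1).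
  by rewrite /L /C ka_mul -[1 ⊗ 1]/(1 : tensor A A) mul1r.
by rewrite step1 -DA step2 step3.
Qed.

(** For [Delta(1) = sum u_j ⊗ v_j], the two sides of [weak_unit] are
    [sum Delta(u_j) ⊗ v_j] and [sum (1 ⊗ u_j) Delta(1) ⊗ v_j], where the [v_j] are
    linearly independent. *)
Lemma D_unit_slice i :
  D (slice (coord (vbasis {:A}) i) (D 1))
  = (1 ⊗ slice (coord (vbasis {:A}) i) (D 1)) * D 1.
Proof.
pose w i := slice (coord (vbasis {:A}) i) (D 1).
have e : \sum_j D (w j) ⊗ (vbasis {:A})`_j
    = \sum_j ((1 ⊗ w j) * D 1) ⊗ (vbasis {:A})`_j.
  apply: tensor_assoc_inj; transitivity (tensor_map idfun D (D 1)).
    rewrite -DA {1}(slice_expand (D 1)) tensor_map_sum !tensor_assoc_sum.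
    by apply: eq_bigr => k _; rewrite tensor_mapE.
  rewrite weak_unit {1}(slice_expand (D 1)) tens_sumr mulr_suml
    tensor_assoc_sum.
  apply: eq_bigr => k _; rewrite -/(w k);
    elim/tens_ind: (D 1) => [s t IHs IHt|a b].
    by rewrite !(mulrDr, tensDl, tensor_assocD) IHs IHt.
  by rewrite !(tensor_assocE, tens_mul) mulr1 !mul1r.
by rewrite -[LHS](slice_sum (fun j => D (w j))) e slice_sum.
Qed.

(** The antipode axiom at [z], once [Delta z] is written as
    [Delta 1 (z ⊗ 1)]: there, [z] only meets the antipode. *)
Lemma antipode_unit z : D z = D 1 * (z ⊗ 1) -> (ka z ⊗ 1) * D 1 = (1 ⊗ z) * D 1.
Proof.
move=> zE; rewrite -[RHS]ka_mul zE.
have D1r x : D x * D 1 = D x by rewrite -DM mulr1.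
have step t : tensor_map D idfun (t * (z ⊗ 1))
    = tensor_map D idfun t * ((z ⊗ 1) ⊗ 1).
  elim/tens_ind: t => [s t IHs IHt|a b].
    by rewrite mulrDl !tensor_mapD IHs IHt mulrDl.
  by rewrite !(tens_mul, tensor_mapE) /= DM zE mulrA D1r.
rewrite step; have -> t : tensor_map (mul_map ka) idfun (t * ((z ⊗ 1) ⊗ 1))
    = (ka z ⊗ 1) * tensor_map (mul_map ka) idfun t.
  elim/tens_ind: t => [s t IHs IHt|ab c].
    by rewrite mulrDl !tensor_mapD IHs IHt mulrDr.
  elim/tens_ind: ab => [s t IHs IHt|a b].
    by rewrite !tensDl mulrDl !tensor_mapD IHs IHt mulrDr.
  have kal : linear ka by move=> k x y; rewrite linearP.
  by rewrite !(tens_mul, tensor_mapE) /= !(mul_mapE _ _ kal) /= kaM mulr1 mul1r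
    mulrA mulr1.
by rewrite ka_mul -[1 ⊗ 1]/(1 : tensor A A) mul1r.
Qed.

End Antipode.

(** * Deforming coproduct, antipode and counit *)

Section Contractions.
Context (F : fieldType) (A : falgType F).

(** With [ka] an antipode, [contraction ka k^-1 (Delta 1)] is the expectation
    that normalises a deforming element [k]. *)
Definition contraction (ka : A -> A) (z : A) : tensor A A -> A :=
  tlift (fun a b => ka a * z * b).
Definition counitl (ep : A -> F) : tensor A A -> A :=
  tlift (fun a b => ep a *: b).
Definition counitr (ep : A -> F) : tensor A A -> A :=
  tlift (fun a b => ep b *: a).
Definition counit2 (ep : A -> F) : tensor A A -> F^o :=
  tlift (fun a b => ep a * ep b : F^o).

Lemma contractionD ka z s t :
  contraction ka z (s + t) = contraction ka z s + contraction ka z t.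
Proof. exact: linearD. Qed.
Lemma contractionZ ka z c s :
  contraction ka z (c *: s) = c *: contraction ka z s.
Proof. exact: linearZ. Qed.
Lemma contraction_sum ka z I (r : seq I) (s : I -> tensor A A) :
  contraction ka z (\sum_(i <- r) s i) = \sum_(i <- r) contraction ka z (s i).
Proof. exact: linear_sum. Qed.
Lemma counitlD ep s t : counitl ep (s + t) = counitl ep s + counitl ep t.
Proof. exact: linearD. Qed.
Lemma counitrD ep s t : counitr ep (s + t) = counitr ep s + counitr ep t.
Proof. exact: linearD. Qed.
Lemma counit2D ep s t : counit2 ep (s + t) = counit2 ep s + counit2 ep t.
Proof. exact: linearD. Qed.

Lemma contractionE ka z a b :
  linear ka -> contraction ka z (a ⊗ b) = ka a * z * b.
Proof.
move=> kl; rewrite /contraction tlift_tens //; split=> [y c x x'|x c y y'].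
  by rewrite kl !mulrDl -!scalerAl.
by rewrite mulrDr scalerAr.
Qed.

Lemma counitlE ep a b : scalar ep -> counitl ep (a ⊗ b) = ep a *: b.
Proof.
move=> el; rewrite /counitl tlift_tens //; split=> [y c x x'|x c y y'].
  by rewrite el scalerDl scalerA.
by rewrite scalerDr !scalerA mulrC.
Qed.

Lemma counitrE ep a b : scalar ep -> counitr ep (a ⊗ b) = ep b *: a.
Proof.
move=> el; rewrite /counitr tlift_tens //; split=> [y c x x'|x c y y'].
  by rewrite scalerDr !scalerA mulrC.
by rewrite el scalerDl scalerA.
Qed.

Lemma counit2E ep a b : scalar ep -> counit2 ep (a ⊗ b) = ep a * ep b.
Proof.
move=> el; rewrite /counit2 tlift_tens //; split=> [y c x x'|x c y y'].
  by rewrite el mulrDl -mulrA.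
by rewrite el mulrDr mulrCA.
Qed.

End Contractions.

Section DeformedHopf.
Context (F : fieldType) (A : falgType F).
Variables (D : {linear A -> tensor A A}) (ka : {linear A -> A})
  (ep : {scalar A}).
Hypothesis DM : forall x y, D (x * y) = D x * D y.
Hypothesis DA :
  forall x, tensor_assoc (tensor_map D idfun (D x)) = tensor_map idfun D (D x).
Hypothesis kaM : forall x y, ka (x * y) = ka y * ka x.
Hypothesis kaD : forall x, tensor_map ka ka (D x) = tensor_flip (D (ka x)).
Hypothesis ka_mul : forall x,
  tensor_map (mul_map ka) idfun (tensor_map D idfun (D x)) = (1 ⊗ x) * D 1.
Hypothesis ep_l : forall x, counitl ep (D x) = x.
Hypothesis ep_r : forall x, counitr ep (D x) = x.
Hypothesis ep_mul : forall x y,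
  counit2 ep ((x ⊗ 1) * D 1 * (1 ⊗ y)) = ep (x * y).

Let u i := slice (coord (vbasis {:A}) i) (D 1).
Hypothesis legs : forall i, D 1 * (u i ⊗ 1) = D 1 * (1 ⊗ ka (u i)).

Variable k : A.
Hypothesis ku : k \is a GRing.unit.
Hypothesis kl : D k = D 1 * (k ⊗ 1).
Hypothesis kr : D k = (k ⊗ 1) * D 1.
Hypothesis k1 : contraction ka k^-1 (D 1) = 1.

Let D' a := D a * (1 ⊗ k^-1).
Let ka' a := k * ka a * k^-1.
Let ep' a := ep (a * k).

Let D1l x : D 1 * D x = D x. Proof. by rewrite -DM mul1r. Qed.
Let D1r x : D x * D 1 = D x. Proof. by rewrite -DM mulr1. Qed.
Let kal : linear ka. Proof. by move=> c x y; rewrite linearP. Qed.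
Let epl : scalar ep. Proof. by move=> c x y; rewrite linearP. Qed.

Let ul : (k^-1 ⊗ 1) * (k ⊗ 1) = 1 :> tensor A A.
Proof. by rewrite tens_mul mulVr ?mulr1. Qed.
Let ul' : (k ⊗ 1) * (k^-1 ⊗ 1) = 1 :> tensor A A.
Proof. by rewrite tens_mul mulrV ?mulr1. Qed.

Let krV : D k^-1 = (k^-1 ⊗ 1) * D 1.
Proof. by rewrite -[LHS]mul1r -ul -mulrA -(D1l k^-1) (mulrA (k ⊗ 1)) -kr -DM
  mulrV. Qed.
Let klV : D k^-1 = D 1 * (k^-1 ⊗ 1).
Proof. by rewrite -[LHS]mulr1 -ul' mulrA -(D1r k^-1) -(mulrA _ _ (k ⊗ 1)) -kl
  -DM mulVr. Qed.
Let DkV x : D (x * k^-1) = D x * (k^-1 ⊗ 1).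
Proof. by rewrite DM klV mulrA D1r. Qed.
Let Dk x : D (x * k) = D x * (k ⊗ 1).
Proof. by rewrite DM kl mulrA D1r. Qed.
Let kD x : D (k * x) = (k ⊗ 1) * D x.
Proof. by rewrite DM kr -mulrA D1l. Qed.

Lemma deformed_D_linear : linear D'.
Proof. by move=> c x y; rewrite /D' linearP mulrDl scalerAl. Qed.

(** The normalisation [k1] is used twice: here, to make the deformed coproduct
    multiplicative, and in [deformed_antipode].  The left legs of the unit are
    moved to the right leg, where they meet [k^-1]. *)
Lemma unit_k_unit : D 1 * (1 ⊗ k^-1) * D 1 = D 1.
Proof.
rewrite {2}(slice_expand (D 1)) mulr_sumr.
under eq_bigr => i _ do
  rewrite -mulrA tens_mul mul1r -{1}[slice _ _]mulr1
    -[X in _ ⊗ X]mul1r -tens_mul mulrA legs -mulrA tens_mul mul1r.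
rewrite -mulr_sumr -tens_sumr.
have -> : \sum_i ka (u i) * (k^-1 * (vbasis {:A})`_i)
    = contraction ka k^-1 (D 1).
  rewrite [in RHS](slice_expand (D 1)) /contraction linear_sum.
  by apply: eq_bigr => i _; rewrite [RHS]contractionE // mulrA.
by rewrite k1 mulr1.
Qed.

Lemma deformed_D_mul x y : D' (x * y) = D' x * D' y.
Proof.
rewrite /D' DM !mulrA; congr (_ * _).
rewrite -[in RHS](D1r x) -[in RHS](D1l y) !mulrA -(mulrA (D x) (D 1)).
by rewrite -(mulrA (D x) (D 1 * _)) unit_k_unit D1r.
Qed.

Lemma deformed_coassoc x :
  tensor_assoc (tensor_map D' idfun (D' x)) = tensor_map idfun D' (D' x).
Proof.
have L t : tensor_map D' idfun (t * (1 ⊗ k^-1))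
    = tensor_map D idfun t * ((1 ⊗ k^-1) ⊗ k^-1).
  elim/tens_ind: t => [s t IHs IHt|a b].
    by rewrite mulrDl !tensor_mapD IHs IHt mulrDl.
  rewrite tens_mul tensor_mapE tensor_mapP //; last exact: deformed_D_linear.
  by rewrite tens_mul mulr1.
have Rt t : tensor_map idfun D' (t * (1 ⊗ k^-1))
    = tensor_map idfun D t * (1 ⊗ (k^-1 ⊗ k^-1)).
  elim/tens_ind: t => [s t IHs IHt|a b].
    by rewrite mulrDl !tensor_mapD IHs IHt mulrDl.
  rewrite tens_mul tensor_mapE tensor_mapP //; last exact: deformed_D_linear.
  by rewrite /D' DkV -mulrA !tens_mul !mulr1 mul1r.
by rewrite /D' L Rt tensor_assoc_mul DA tensor_assocE.
Qed.

Lemma deformed_ka_linear : linear ka'.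
Proof. by move=> c x y; rewrite /ka' linearP mulrDr mulrDl -scalerAr -scalerAl.
  Qed.

Lemma deformed_ka_mul x y : ka' (x * y) = ka' y * ka' x.
Proof. by rewrite /ka' kaM !mulrA mulrVK. Qed.

Lemma deformed_ka_D x :
  tensor_map ka' ka' (D' x) = tensor_flip (D' (ka' x)).
Proof.
have L t : tensor_map ka' ka' t = (k ⊗ k) * tensor_map ka ka t * (k^-1 ⊗ k^-1).
  elim/tens_ind: t => [s t IHs IHt|a b].
    by rewrite !tensor_mapD mulrDr mulrDl IHs IHt.
  rewrite tensor_mapE tensor_mapP; try exact: deformed_ka_linear.
  by rewrite !tens_mul.
have M t : tensor_map ka ka (t * (1 ⊗ k^-1))
    = (1 ⊗ ka k^-1) * tensor_map ka ka t.
  elim/tens_ind: t => [s t IHs IHt|a b].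
    by rewrite mulrDl !tensor_mapD mulrDr IHs IHt.
  by rewrite tens_mul mulr1 !tensor_mapE tens_mul kaM mul1r.
rewrite L M kaD; apply: (can_inj (@tensor_flipK _ _ _)).
rewrite tensor_flipK !tensor_flip_mul !tensor_flipE tensor_flipK /D' DkV kD.
(* [k] on the right leg of [Delta] is [kappa(k)] on the left one *)
have e : (ka k^-1 ⊗ k) * D (ka x) = D (ka x).
  rewrite -{1}(D1l (ka x)) mulrA.
  have -> : ka k^-1 ⊗ k = (ka k^-1 ⊗ 1) * (1 ⊗ k)
    by rewrite tens_mul mul1r mulr1.
  rewrite -(mulrA _ (1 ⊗ k) (D 1)) -(antipode_unit DM kaM ka_mul kl) mulrA
    tens_mul -kaM mulrV // mulr1.
  have -> : ka 1 = 1.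
    have h t : ka 1 * contraction ka k^-1 t = contraction ka k^-1 t.
      elim/tens_ind: t => [s t IHs IHt|a b].
        by rewrite contractionD mulrDr IHs IHt.
      by rewrite contractionE // !mulrA -kaM mulr1.
    by have := h (D 1); rewrite k1 mulr1.
  by rewrite mul1r D1l.
have -> : k ⊗ k = (k ⊗ 1) * (1 ⊗ k) by rewrite tens_mul mul1r mulr1.
have -> : k^-1 ⊗ k^-1 = (k^-1 ⊗ 1) * (1 ⊗ k^-1) by rewrite tens_mul mul1r mulr1.
rewrite !mulrA -[in RHS]e; congr (_ * _ * _); rewrite -!mulrA; congr (_ * _).
by rewrite mulrA tens_mul mul1r mulr1.
Qed.

(** The deformed contraction inserts [k^-1] between [kappa(x1)] and [x2]; as
    [Delta(x) = Delta(1) Delta(x)], the legs of [Delta(1)] surround it and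
    [k1] removes it. *)
Lemma deformed_antipode x :
  tensor_map (mul_map ka') idfun (tensor_map D' idfun (D' x)) = (1 ⊗ x) * D' 1.
Proof.
have C t : contraction ka k^-1 (D 1 * t) = mul_map ka t.
  elim/tens_ind: t => [s t IHs IHt|c d];
    first by rewrite mulrDr contractionD mul_mapD IHs IHt.
  rewrite (mul_mapE _ _ kal) -[ka c]mulr1 -[X in _ * X * _]k1.
  elim/tens_ind: (D 1) => [s t IHs IHt|a b].
    by rewrite mulrDl !contractionD mulrDr mulrDl IHs IHt.
  by rewrite tens_mul !contractionE // kaM !mulrA.
have N t : mul_map ka' (t * (1 ⊗ k^-1)) = k * contraction ka k^-1 t * k^-1.
  elim/tens_ind: t => [s t IHs IHt|c d].
    by rewrite mulrDl mul_mapD contractionD mulrDr mulrDl IHs IHt.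
  by rewrite tens_mul (mul_mapE _ _ deformed_ka_linear) contractionE // mulr1
    /ka' !mulrA.
have T t : tensor_map (mul_map ka') idfun (tensor_map D' idfun (t * (1 ⊗ k^-1)))
   = (k ⊗ 1) * tensor_map (mul_map ka) idfun (tensor_map D idfun t) *
     (k^-1 ⊗ k^-1).
  elim/tens_ind: t => [s t IHs IHt|a b].
    by rewrite mulrDl !tensor_mapD mulrDr mulrDl IHs IHt.
  rewrite tens_mul (tensor_mapP _ _ deformed_D_linear) // !tensor_mapE /=.
  by rewrite mulr1 /D' N -{1}(D1l a) C !tens_mul mul1r.
rewrite /D' T ka_mul.
have -> : k^-1 ⊗ k^-1 = (k^-1 ⊗ 1) * (1 ⊗ k^-1) by rewrite tens_mul mul1r mulr1.
rewrite !mulrA; congr (_ * _).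
rewrite -(mulrA _ (D 1)) -klV krV mulrA; congr (_ * _).
by rewrite !tens_mul !mulr1 mul1r mulrV.
Qed.

Lemma deformed_ep_scalar : scalar ep'.
Proof. by move=> c x y; rewrite /ep' mulrDl -scalerAl linearP. Qed.

Lemma deformed_counitl x : counitl ep' (D' x) = x.
Proof.
have L t : counitl ep' (t * (1 ⊗ k^-1)) = counitl ep (t * (k ⊗ 1)) * k^-1.
  elim/tens_ind: t => [s t IHs IHt|a b].
    by rewrite !mulrDl !counitlD IHs IHt mulrDl.
  rewrite !tens_mul (counitlE _ _ deformed_ep_scalar) (counitlE _ _ epl).
  by rewrite !mulr1 /ep' scalerAl.
by rewrite /D' L -Dk ep_l mulrK.
Qed.

Lemma deformed_counitr x : counitr ep' (D' x) = x.
Proof.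
have L t : counitr ep' (t * (1 ⊗ k^-1)) = counitr ep t.
  elim/tens_ind: t => [s t IHs IHt|a b].
    by rewrite !mulrDl !counitrD IHs IHt.
  rewrite !tens_mul (counitrE _ _ deformed_ep_scalar) (counitrE _ _ epl).
  by rewrite mulr1 /ep' mulrVK.
by rewrite /D' L ep_r.
Qed.

Lemma deformed_counit2 x y :
  counit2 ep' ((x ⊗ 1) * D' 1 * (1 ⊗ y)) = ep' (x * y).
Proof.
have L t : counit2 ep' t = counit2 ep (t * (k ⊗ k)).
  elim/tens_ind: t => [s t IHs IHt|a b].
    by rewrite !mulrDl !counit2D IHs IHt.
  by rewrite !tens_mul (counit2E _ _ deformed_ep_scalar) (counit2E _ _ epl).
rewrite L /ep'.
have -> : x * y * k = (x * k) * (k^-1 * y * k) by rewrite !mulrA mulrK.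
rewrite -ep_mul; congr (counit2 ep _).
have -> : ((x * k) ⊗ 1) * D 1 = (x ⊗ 1) * D 1 * (k ⊗ 1).
  by rewrite -mulrA -kl kr mulrA tens_mul mulr1.
rewrite /D' !mulrA -!(mulrA ((x ⊗ 1) * D 1)); congr (_ * _).
by rewrite !tens_mul !mulr1 !mul1r.
Qed.

End DeformedHopf.

(** * Involutive algebras with a faithful positive form *)

Section PositiveForm.
Context (C : numClosedFieldType) (A : falgType C).
Variables (st : A -> A) (ep : {scalar A}).
Hypothesis st_conj : forall c x y, st (c *: x + y) = c^* *: st x + st y.
Hypothesis stK : involutive st.
Hypothesis stM : forall x y, st (x * y) = st y * st x.
Hypothesis ep_ge0 : forall x, 0 <= ep (st x * x).

Lemma invol_add x y : st (x + y) = st x + st y.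
Proof. by have := st_conj 1 x y; rewrite !scale1r rmorph1 scale1r. Qed.
Lemma invol0 : st 0 = 0.
Proof. by apply: (addrI (st 0)); rewrite -invol_add !addr0. Qed.
Lemma invol_scale c x : st (c *: x) = c^* *: st x.
Proof. by have := st_conj c x 0; rewrite invol0 !addr0. Qed.
Lemma invol1 : st 1 = 1.
Proof. by have := stM 1 (st 1); rewrite mul1r !stK mul1r => <-. Qed.
Lemma invol_sum I (r : seq I) (F : I -> A) :
  st (\sum_(i <- r) F i) = \sum_(i <- r) st (F i).
Proof. by elim/big_rec2: _ => [|i x y _ <-]; rewrite ?invol0 ?invol_add. Qed.

Lemma invol_unit x : x \is a GRing.unit -> st x \is a GRing.unit.
Proof.
by move=> xu; apply/unitrP; exists (st x^-1);
  rewrite -!stM mulrV // mulVr ?invol1.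
Qed.
Lemma invol_inv x : x \is a GRing.unit -> st x^-1 = (st x)^-1.
Proof.
move=> xu; apply: (mulrI (invol_unit xu)).
by rewrite -stM mulVr // invol1 mulrV ?invol_unit.
Qed.

Let ip x y := ep (st x * y).

Let ipDr x y z : ip x (y + z) = ip x y + ip x z.
Proof. by rewrite /ip mulrDr linearD. Qed.
Let ipZr c x y : ip x (c *: y) = c * ip x y.
Proof. by rewrite /ip -scalerAr linearZ. Qed.
Let ipDl x y z : ip (x + y) z = ip x z + ip y z.
Proof. by rewrite /ip invol_add mulrDl linearD. Qed.
Let ipZl c x y : ip (c *: x) y = c^* * ip x y.
Proof. by rewrite /ip invol_scale -scalerAl linearZ. Qed.
Let ip_real x : (ip x x)^* = ip x x.
Proof. exact/CrealP/ger0_real/ep_ge0. Qed.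

(** Polarisation: the form takes real values on the vectors [x + c y], for
    [c = 1] and [c = i]. *)
Lemma form_hermitian x y : ep (st y * x) = (ep (st x * y))^*.
Proof.
rewrite -/(ip x y) -/(ip y x).
have f c : (c * ip x y + c^* * ip y x)^* = c * ip x y + c^* * ip y x.
  have -> : c * ip x y + c^* * ip y x
      = ip (x + c *: y) (x + c *: y) - ip x x - c * c^* * ip y y.
    by rewrite !(ipDl, ipDr, ipZl, ipZr); ring.
  by rewrite !rmorphB !rmorphM /= !ip_real conjCK [c^* * c]mulrC.
have := f 1; rewrite rmorph1 !mul1r rmorphD => e1.
have := f 'i; rewrite conjCi rmorphD !rmorphM rmorphN /= conjCi opprK !mulNr =>
  e2.
have e3 : (ip x y)^* - (ip y x)^* = ip y x - ip x y.
  apply: (mulfI (neq0Ci C)); rewrite !mulrBr -[RHS]opprB -e2.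
  by rewrite opprD opprK.
apply: (mulfI (_ : 2%:R != 0)); first by rewrite pnatr_eq0.
have := congr2 +%R e1 e3; rewrite addrACA subrr addr0 addrACA [ip x y + _]addrC.
by rewrite addrACA subrr addr0 -!mulr2n !mulr_natl => ->.
Qed.

Let ip_herm x y : ip y x = (ip x y)^*. Proof. exact: form_hermitian. Qed.

(** The Cauchy-Schwarz inequality for a null vector [y], from the positivity at
    [x - t <y, x> y], which is affine in the real number [t]. *)
Lemma form_null x y : ep (st y * y) = 0 -> ep (st y * x) = 0.
Proof.
rewrite -/(ip y y) -/(ip y x) => y0; apply/eqP/negPn/negP => a0.
set a := ip y x in a0; have m0 : 0 < a * a^* by rewrite mul_conjC_gt0.
(* at this [t] the affine function takes the value [-1] *)
pose t := (ip x x + 1) / (2%:R * (a * a^*)).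
have X0 : 0 <= ip x x by exact: ep_ge0.
have tr : t^* = t.
  apply/CrealP/ger0_real; rewrite divr_ge0 ?addr_ge0 // mulr_ge0 //.
  exact: ltW.
have := ep_ge0 (x + (- (t * a)) *: y); rewrite -/(ip _ _).
rewrite !(ipDl, ipDr, ipZl, ipZr) y0 !mulr0 addr0 (ip_herm y x) -/a rmorphN
  rmorphM /= tr.
have -> : ip x x + - (t * a^*) * a + - (t * a) * a^*
    = ip x x - t * (2%:R * (a * a^*)) by ring.
rewrite divfK; last by rewrite mulf_neq0 ?pnatr_eq0 // gt_eqF.
by rewrite opprD addrA subrr sub0r oppr_ge0 ler10.
Qed.

Section Subalgebra.
Variable B : {pred A}.
Hypothesis B1 : 1 \in B.
Hypothesis BD : {in B &, forall x y, x + y \in B}.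
Hypothesis BZ : forall c, {in B, forall x, c *: x \in B}.
Hypothesis BM : {in B &, forall x y, x * y \in B}.
Hypothesis ep_faithful : {in B, forall x, ep (st x * x) = 0 -> x = 0}.

Lemma subalg0 : 0 \in B. Proof. by rewrite -(scale0r (1 : A)) BZ. Qed.
Lemma subalgN x : x \in B -> - x \in B.
Proof. by move=> xB; rewrite -scaleN1r BZ. Qed.
(** The Gram-Schmidt process, for a family that may be linearly dependent.  Of
    the orthonormal family [X] only the reproducing formula is retained. *)
Lemma gram_schmidt (s : seq A) : {subset s <= B} ->
  exists2 X : seq A, {subset X <= B} &
    {in s, forall v, v = \sum_(f <- X) ep (st f * v) *: f}.
Proof.
move=> sB; pose P (X : seq A) v := \sum_(f <- X) ip f v *: f.
(* Reproducing its own elements makes [P X] the orthogonal projection. *)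
suff [X [XB XX Xs]] : exists X : seq A,
    [/\ {subset X <= B}, {in X, forall v, v = P X v} &
      {in s, forall v, v = P X v}].
  by exists X.
elim: s sB => [_|v s IH vsB]; first by exists [::].
have [|X [XB XX Xs]] := IH; first by move=> x xs; rewrite vsB // inE xs orbT.
have vB : v \in B by rewrite vsB // mem_head.
have ip_suml I (r : seq I) (F : I -> A) y :
    ip (\sum_(i <- r) F i) y = \sum_(i <- r) ip (F i) y.
  by rewrite /ip invol_sum mulr_suml linear_sum.
have ip_sumr I (r : seq I) (F : I -> A) y :
    ip y (\sum_(i <- r) F i) = \sum_(i <- r) ip y (F i).
  by rewrite /ip mulr_sumr linear_sum.
have PB w : P X w \in B.
  rewrite /P big_seq; apply: (big_ind (fun x => x \in B)) => [||f fX];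
    [exact: subalg0|exact: BD|].
  by rewrite BZ ?XB.
have orth g w : g \in X -> ip g (w - P X w) = 0.
  move=> gX; rewrite ipDr -scaleN1r ipZr mulN1r {1}(XX g gX) /P ip_suml ip_sumr.
  apply/eqP; rewrite subr_eq0; apply/eqP/eq_bigr => f _.
  by rewrite ipZl ipZr -ip_herm mulrC.
have orthP u w : {in X, forall g, ip g u = 0} -> ip u (P X w) = 0.
  move=> Xu; rewrite /P ip_sumr big_seq big1 // => f fX.
  by rewrite ipZr (ip_herm f u) Xu // rmorph0 mulr0.
pose u := v - P X v; have Xu : {in X, forall g, ip g u = 0} by move=> g;
  apply: orth.
have uB : u \in B by rewrite BD ?subalgN.
have [u0|u0] := eqVneq u 0.
  exists X; split=> // w; rewrite inE => /orP[/eqP->|]; last exact: Xs.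
  by apply/eqP; rewrite -subr_eq0 -/u u0.
pose c := sqrtC (ip u u); pose e := c^-1 *: u.
have c0 : 0 < c.
  rewrite sqrtC_gt0 lt_def ep_ge0 andbT.
  by apply: contra u0 => /eqP/ep_faithful ->.
have ee : ip e e = 1.
  rewrite ipZl ipZr fmorphV /= conj_Creal ?gtr0_real // mulrA -invfM -expr2
    sqrtCK.
  by rewrite mulVf // -sqrtC_eq0 gt_eqF.
have Xe : {in X, forall g, ip g e = 0} by move=> g gX; rewrite ipZr Xu ?mulr0.
have PE w : P (e :: X) w = ip e w *: e + P X w by rewrite /P big_cons.
have eX w : w = P X w -> w = P (e :: X) w.
  by move=> wX; rewrite PE -wX {2}wX orthP // scale0r add0r.
exists (e :: X); split=> w; rewrite ?inE => /orP[/eqP->|].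
- by rewrite BZ.
- exact: XB.
- rewrite PE ee scale1r /P big_seq big1 ?addr0 // => f fX.
  by rewrite Xe ?scale0r.
- by move=> /XX/eX.
- have ev : ip e v = c.
    have -> : v = u + P X v by rewrite subrK.
    rewrite ipDr orthP // addr0 ipZl fmorphV /= conj_Creal ?gtr0_real //.
    by rewrite -[ip u u]sqrtCK expr2 mulKf // gt_eqF.
  by rewrite PE ev scalerA mulfV ?gt_eqF // scale1r subrK.
- by move=> /Xs/eX.
Qed.

(** The separation hypothesis makes a sum of squares strictly positive: its
    value at [z] is the sum of the squared norms of the [y z]. *)
Lemma squares_positive (Y : seq A) : {subset Y <= B} ->
  (forall z, {in Y, forall y, y * z = 0} -> z = 0) ->
  {in B, forall z, z != 0 -> 0 < ep (st z * ((\sum_(y <- Y) st y * y) * z))}.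
Proof.
move=> YB Ysep z zB z0.
have -> : ep (st z * ((\sum_(y <- Y) st y * y) * z))
    = \sum_(y <- Y) ep (st (y * z) * (y * z)).
  rewrite mulr_suml mulr_sumr linear_sum; apply: eq_bigr => y _.
  by rewrite stM !mulrA.
rewrite lt_def sumr_ge0 ?andbT => [|y _]; last exact: ep_ge0.
apply: contra z0 => /eqP sum0; apply/eqP/Ysep => y yY; apply: ep_faithful.
  by apply: BM => //; apply: YB.
move/eqP: sum0; rewrite psumr_eq0 => [|w _]; last exact: ep_ge0.
by move/allP/(_ y yY)/eqP.
Qed.

Section Spectral.
Variable a : A.
Hypotheses (aB : a \in B) (a_sa : st a = a).

Let ev p := horner_alg a p.
Let evMXC p c : ev (p * 'X + c%:P) = ev p * a + c%:A.
Proof. by rewrite /ev rmorphD rmorphM /= horner_algX horner_algC. Qed.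

Let evZ c p : ev (c *: p) = c *: ev p.
Proof. by rewrite /ev linearZ /= -scalerAl mul1r. Qed.

Lemma ev_sub p : ev p \in B.
Proof.
elim/poly_ind: p => [|p c IH]; first by rewrite /ev rmorph0 subalg0.
by rewrite evMXC BD ?BM ?BZ.
Qed.

Lemma ev_comm p x : x * a = a * x -> x * ev p = ev p * x.
Proof.
move=> xa; elim/poly_ind: p => [|p c IH];
  first by rewrite /ev rmorph0 mulr0 mul0r.
by rewrite evMXC mulrDr mulrDl !mulrA IH -(mulrA _ x a) xa mulrA -scalerAl
  -scalerAr mul1r mulr1.
Qed.

Lemma ev_eigen p l x : a * x = l *: x -> ev p * x = p.[l] *: x.
Proof.
move=> ax; elim/poly_ind: p => [|p c IH].
  by rewrite /ev rmorph0 horner0 mul0r scale0r.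
by rewrite evMXC hornerMXaddC mulrDl -mulrA ax -scalerAr IH scalerA mulrC
  -scalerAl mul1r scalerDl.
Qed.

(** The powers of [a] are linearly dependent. *)
Lemma ev_annihilated : exists2 p : {poly C}, p != 0 & ev p = 0.
Proof.
pose n := \dim {:A}; pose X := [tuple a ^+ i | i < n.+1].
have : ~~ free X.
  apply/negP => /eqP fX; have := dimvS (subvf <<X>>%VS).
  by rewrite fX size_tuple ltnn.
move/freeP/existsNP => [k /not_implyP[kX /existsNP[i /eqP ki]]].
exists (\poly_(j < n.+1) k (inord j)).
  apply/eqP => /polyP/(_ i); rewrite coef_poly coef0 ltn_ord inord_val.
  by apply/eqP.
rewrite poly_def /ev linear_sum -[RHS]kX; apply: eq_bigr => j _.
rewrite linearZ /= rmorphXn /= horner_algX inord_val.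
by rewrite (nth_map j) ?size_enum_ord // nth_ord_enum -scalerAl mul1r.
Qed.

Let Pi s : {poly C} := \prod_(l <- s) ('X - l%:P).

(** The minimal polynomial, as the list of its roots: minimality is what the
    spectral theorem uses. *)
Lemma ev_roots : exists2 s, ev (Pi s) = 0 &
  forall s', ev (Pi s') = 0 -> (size s <= size s')%N.
Proof.
have [p p0 ep0] := ev_annihilated.
have ex : exists n, `[< exists2 s, ev (Pi s) = 0 & size s = n >].
  have [s pE] := closed_field_poly_normal p.
  exists (size s); apply/asboolP; exists s => //.
  have lc : lead_coef p != 0 by rewrite lead_coef_eq0.
  apply: (scalerI lc); by rewrite scaler0 -ep0 [in RHS]pE evZ.
case: (ex_minnP ex) => n /asboolP[s s0 <-] smin; exists s => // s' s'0.
by apply: smin; apply/asboolP; exists s'.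
Qed.

(** A nonzero [x] with [a x = l x] gives [l <x, x> = <x, a x> = l^* <x, x>], and
    [(a - l)^2 y = 0] with [l] real makes [(a - l) y] a null vector.  As the
    form is faithful, the roots of the minimal polynomial are real and simple;
    the projections are the values at [a] of its Lagrange polynomials. *)
Theorem spectral : exists s : seq C, exists P : C -> A,
  [/\ uniq s,
      {in s, forall l, [/\ l^* = l, P l \in B, P l != 0, st (P l) = P l &
                           a * P l = l *: P l]},
      forall l x, x * a = a * x -> x * P l = P l * x,
      {in s &, forall l m, P l * P m = if l == m then P l else 0} &
      \sum_(l <- s) P l = 1].
Proof.
have [s s0 smin] := ev_roots.
have ev_lin l : ev ('X - l%:P) = a - l%:A.
  by rewrite /ev rmorphB /= horner_algX horner_algC.
have rem0 l : l \in s -> ev (Pi (rem l s)) != 0.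
  move=> ls; apply/eqP => /smin; rewrite size_rem //.
  by case: (s) ls => // x t _; rewrite ltnn.
have remE l : l \in s -> Pi s = ('X - l%:P) * Pi (rem l s).
  by move=> ls; rewrite /Pi (perm_big _ (perm_to_rem ls)) big_cons.
have eig l : l \in s -> a * ev (Pi (rem l s)) = l *: ev (Pi (rem l s)).
  move=> ls; apply/eqP; rewrite -subr_eq0 -{2}[ev _]mul1r scalerAl -mulrBl.
  by rewrite -ev_lin /ev -rmorphM -remE //; apply/eqP.
have real l : l \in s -> l^* = l.
  move=> ls; have el := eig l ls; set x := ev _ in el; have xB : x \in B :=
    ev_sub _.
  have e1 : ep (st x * (a * x)) = l * ep (st x * x).
    by rewrite el -scalerAr linearZ.
  have e2 : ep (st x * (a * x)) = l^* * ep (st x * x).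
    by rewrite mulrA -{1}a_sa -stM el invol_scale -scalerAl linearZ.
  apply: (mulIf (_ : ep (st x * x) != 0)); last by rewrite -e1 -e2.
  by apply: contra (rem0 l ls) => /eqP/(ep_faithful xB) xz; apply/eqP.
have us : uniq s.
  apply: count_mem_uniq => l; have [ls|ls] := boolP (l \in s); last first.
    by apply/count_memPn.
  rewrite (permP (perm_to_rem ls)) /= eqxx (count_memPn _) //;
    apply/negP => ls'.
  set x := ev (Pi (rem l s)); set y := ev (Pi (rem l (rem l s))).
  have xE : x = (a - l%:A) * y.
    by rewrite -ev_lin /y /ev -rmorphM /x /Pi (perm_big _ (perm_to_rem ls'))
      big_cons.
  suff /(ep_faithful (ev_sub _)) x0 : ep (st x * x) = 0.
    by have /eqP := rem0 l ls; apply.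
  rewrite {1}xE stM -scaleN1r scalerA invol_add a_sa invol_scale invol1.
  rewrite rmorphM rmorphN1 /= real // mulN1r scaleNr -mulrA mulrBl -scalerAl
    mul1r.
  by rewrite eig // subrr mulr0 linear0.
pose L l : {poly C} := (Pi (rem l s)).[l]^-1 *: Pi (rem l s).
have Pi_neq0 l : l \in s -> (Pi (rem l s)).[l] != 0.
  move=> ls; rewrite horner_prod prodf_seq_neq0; apply/allP => m.
  rewrite mem_rem_uniq // inE => /andP[ml _] /=.
  by rewrite hornerXsubC subr_eq0 eq_sym.
have LE l m : l \in s -> m \in s -> (L l).[m] = (l == m)%:R.
  move=> ls ms; rewrite /L hornerZ; have [<-|lm] := eqVneq l m.
    by rewrite mulVf ?Pi_neq0.
  have mr : m \in rem l s by rewrite mem_rem_uniq // inE eq_sym lm.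
  have -> : (Pi (rem l s)).[m] = 0; last by rewrite mulr0.
  by rewrite /Pi (perm_big _ (perm_to_rem mr)) big_cons hornerM hornerXsubC
    subrr mul0r.
have Lsum : \sum_(l <- s) L l = 1.
  apply/eqP; rewrite -subr_eq0; apply/negPn/negP => n0.
  have := max_poly_roots n0 _ us.
  have -> : all (root (\sum_(l <- s) L l - 1)) s.
    apply/allP => m ms; rewrite /root hornerD hornerN hornerC horner_sum.
    rewrite (bigD1_seq m) //= LE // eqxx big_seq_cond big1 ?addr0 ?subrr //.
    by move=> l /andP[ls lm]; rewrite LE // (negPf lm).
  move=> /(_ isT); rewrite ltnNge => /negP; apply.
  have s0' : (0 < size s)%N.
    by case: (s) s0 => // /eqP; rewrite /Pi big_nil /ev rmorph1 oner_eq0.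
  apply: (leq_trans (size_polyD _ _));
    rewrite geq_max size_polyN size_poly1 s0' andbT.
  rewrite big_seq; apply: (big_ind (fun p : {poly C} => (size p <= size s)%N)).
  - by rewrite size_poly0.
  - by move=> p q hp hq; rewrite (leq_trans (size_polyD _ _)) // geq_max hp.
  move=> l ls; rewrite (leq_trans (size_scale_leq _ _)) //.
  by rewrite /Pi size_prod_XsubC size_rem // prednK.
have aP l : l \in s -> a * ev (L l) = l *: ev (L l).
  by move=> ls; rewrite evZ -scalerAr eig // !scalerA mulrC.
have PP : {in s &, forall l m,
    ev (L l) * ev (L m) = if l == m then ev (L l) else 0}.
  move=> l m ls ms; rewrite (ev_eigen _ (aP m ms)) LE //.
  by have [->|_] := eqVneq l m; rewrite ?scale1r ?scale0r.
have Psum : \sum_(l <- s) ev (L l) = 1 by rewrite /ev -linear_sum Lsum rmorph1.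
exists s, (fun l => ev (L l)); split=> //; last by move=> l x; apply: ev_comm.
move=> l ls; split; rewrite ?real ?ev_sub ?aP //.
  by rewrite evZ scaler_eq0 invr_eq0 negb_or Pi_neq0 ?rem0.
(* eigenspaces of a self-adjoint element are orthogonal, which makes [P l]
   equal to [(P l)^* (P l)], a self-adjoint element *)
have cross m : m \in s -> m != l -> st (ev (L m)) * ev (L l) = 0.
  move=> ms ml; apply/eqP.
  have : (m - l) *: (st (ev (L m)) * ev (L l)) == 0.
    rewrite scalerBl subr_eq0 scalerAl -[X in X *: st _]real // -invol_scale.
    by rewrite -aP // stM a_sa -mulrA aP // -scalerAr.
  by rewrite scaler_eq0 subr_eq0 (negPf ml).
have h : ev (L l) = st (ev (L l)) * ev (L l).
  rewrite -[LHS]mul1r -{1}invol1 -Psum invol_sum mulr_suml (bigD1_seq l) //=.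
  by rewrite big_seq_cond big1 ?addr0 // => m /andP[ms ml]; apply: cross.
by rewrite h stM stK.
Qed.

(** The square root is taken on the eigenvalues, which are positive. *)
Lemma positive_root :
  {in B, forall z, z != 0 -> 0 < ep (st z * (a * z))} ->
  exists c, [/\ c \in B /\ c^-1 \in B, c \is a GRing.unit, st c = c, c * c = a &
                forall x, x * a = a * x -> x * c = c * x].
Proof.
move=> a_pos; have [s [P [us sP Pcomm PP Psum]]] := spectral.
have l_pos l : l \in s -> 0 < l.
  move=> ls; have [_ PB P0 Psa aP] := sP l ls.
  have := a_pos _ PB P0; rewrite aP -scalerAr linearZ /= pmulr_lgt0 //.
  rewrite lt_def ep_ge0 andbT; apply: contra P0 => /eqP/(ep_faithful PB) ->.
  exact: eqxx.
pose f (g : C -> C) := \sum_(l <- s) g l *: P l.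
have fM g h : f g * f h = f (fun l => g l * h l).
  rewrite /f mulr_suml big_seq [RHS]big_seq; apply: eq_bigr => l ls.
  rewrite mulr_sumr (bigD1_seq l) //= big_seq_cond big1 ?addr0 => [|m].
    by rewrite -scalerAl -scalerAr PP // eqxx scalerA.
  case/andP=> ms ml.
  by rewrite -scalerAl -scalerAr PP // eq_sym (negPf ml) !scaler0.
have fB g : f g \in B.
  rewrite /f big_seq; apply: (big_ind (fun x => x \in B)) => [||l ls].
  - exact: subalg0.
  - exact: BD.
  by have [_ PB _ _ _] := sP l ls; rewrite BZ.
have f1 g : {in s, forall l, g l = 1} -> f g = 1.
  move=> g1; rewrite /f -Psum big_seq [RHS]big_seq; apply: eq_bigr => l ls.
  by rewrite g1 // scale1r.
pose c := f (fun l => sqrtC l); pose c' := f (fun l => (sqrtC l)^-1).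
have cc' : c * c' = 1.
  by rewrite fM f1 // => l /l_pos l0; rewrite mulfV // gt_eqF // sqrtC_gt0.
have c'c : c' * c = 1.
  by rewrite fM f1 // => l /l_pos l0; rewrite mulVf // gt_eqF // sqrtC_gt0.
have cu : c \is a GRing.unit by apply/unitrP; exists c'.
have cV : c^-1 = c' by apply: (mulrI cu); rewrite mulrV.
exists c; rewrite cV; split=> //; first by split; apply: fB.
- rewrite /c /f invol_sum big_seq [RHS]big_seq; apply: eq_bigr => l ls.
  have [_ _ _ Psa _] := sP l ls; rewrite invol_scale Psa conj_Creal //.
  by rewrite ger0_real // sqrtC_ge0 ltW ?l_pos.
- rewrite fM /f -[RHS]mulr1 -Psum mulr_sumr big_seq [RHS]big_seq.
  apply: eq_bigr => l ls; have [_ _ _ _ ->] := sP l ls.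
  by rewrite -expr2 sqrtCK.
- move=> x xa; rewrite /c /f mulr_sumr mulr_suml; apply: eq_bigr => l _.
  by rewrite -scalerAl -scalerAr Pcomm.
Qed.

(** An element that commutes with the spectral projections of [a] commutes
    with [a]. *)
Lemma noncommuting_projection y : a * y <> y * a ->
  exists p, [/\ p \in B, st p = p, p * p = p,
                forall x, x * a = a * x -> x * p = p * x & p * y <> y * p].
Proof.
move=> ay; have [s [P [us sP Pcomm PP Psum]]] := spectral.
have [l [ls ly]] : exists l, l \in s /\ P l * y <> y * P l.
  apply: contra_notP ay => /forallNP Py.
  rewrite -[a]mulr1 -Psum mulr_sumr mulr_suml mulr_sumr big_seq [RHS]big_seq.
  apply: eq_bigr => l ls; have [_ _ _ _ ->] := sP l ls.
  by rewrite -scalerAl -scalerAr; congr (_ *: _); apply: contra_notP (Py l).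
have [_ PB _ Psa _] := sP l ls.
by exists (P l); split=> //; [rewrite PP // eqxx | move=> x; apply: Pcomm].
Qed.

End Spectral.
End Subalgebra.

End PositiveForm.

(** * The Cartan subalgebras *)

Section StarWeakHopf.
Context (C : numClosedFieldType) (A : falgType C).

(** A quantum groupoid without its norm, over any numerical closed field.
    The involution [stt] of the tensor product is part of the data, so that only
    its values on pure tensors matter. *)
Record star_weak_hopf (st : A -> A) (stt : tensor A A -> tensor A A)
    (D : {linear A -> tensor A A}) (ka : {linear A -> A}) (ep : {scalar A}) :
    Prop := StarWeakHopf {
  wh_st_conj : forall c x y, st (c *: x + y) = c^* *: st x + st y;
  wh_stK : involutive st;
  wh_st_mul : forall x y, st (x * y) = st y * st x;
  wh_sttD : forall s t, stt (s + t) = stt s + stt t;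
  wh_sttE : forall a b, stt (a ⊗ b) = st a ⊗ st b;
  wh_D_mul : forall x y, D (x * y) = D x * D y;
  wh_D_st : forall x, D (st x) = stt (D x);
  wh_D_coassoc : forall x,
    tensor_assoc (tensor_map D idfun (D x)) = tensor_map idfun D (D x);
  wh_ka_st : forall x, ka (st (ka (st x))) = x;
  wh_ka_mul : forall x y, ka (x * y) = ka y * ka x;
  wh_ka_D : forall x, tensor_map ka ka (D x) = tensor_flip (D (ka x));
  wh_antipode : forall x,
    tensor_map (mul_map ka) idfun (tensor_map D idfun (D x)) = (1 ⊗ x) * D 1;
  wh_ep_ge0 : forall x, 0 <= ep (st x * x);
  wh_ep_idl : forall x, counitl ep (D x) = x;
  wh_ep_idr : forall x, counitr ep (D x) = x;
  wh_ep_mul : forall x y,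
    counit2 ep ((x ⊗ 1) * D 1 * (1 ⊗ y)) = ep (x * y) }.

Context (st : A -> A) (stt : tensor A A -> tensor A A).
Context (D : {linear A -> tensor A A}) (ka : {linear A -> A}) (ep : {scalar A}).
Hypothesis wh : star_weak_hopf st stt D ka ep.

Let st_conj := wh_st_conj wh.
Let stK := wh_stK wh.
Let stM := wh_st_mul wh.
Let D_mul := wh_D_mul wh.
Let D_st := wh_D_st wh.
Let ka_mul := wh_ka_mul wh.
Let ka_st := wh_ka_st wh.
Let ka_D := wh_ka_D wh.
Let sttE := wh_sttE wh.
Let st0 : st 0 = 0 := invol0 st_conj.
Let st1 : st 1 = 1 := invol1 stK stM.

Lemma st_antipodeK x : st (ka (st (ka x))) = x.
Proof. by apply: (can_inj stK); rewrite stK -[RHS]ka_st stK. Qed.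
Lemma ka_inj : injective ka. Proof. exact:
  (can_inj (g := fun x => st (ka (st x))) st_antipodeK). Qed.
Lemma ka1 : ka 1 = 1.
Proof. by rewrite -[LHS]mulr1 -{2}(ka_st 1) -ka_mul mulr1 ka_st. Qed.
Lemma kaV x : x \is a GRing.unit -> ka x \is a GRing.unit /\ ka x^-1
  = (ka x)^-1.
Proof.
move=> xu; have h1 : ka x^-1 * ka x = 1 by rewrite -ka_mul mulrV ?ka1.
have h2 : ka x * ka x^-1 = 1 by rewrite -ka_mul mulVr ?ka1.
have su : ka x \is a GRing.unit by apply/unitrP; exists (ka x^-1).
by split=> //; apply: (mulrI su); rewrite h2 mulrV.
Qed.

Lemma D1l x : D 1 * D x = D x. Proof. by rewrite -D_mul mul1r. Qed.
Lemma D1r x : D x * D 1 = D x. Proof. by rewrite -D_mul mulr1. Qed.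
Lemma D_inj : injective D.
Proof. by move=> x y e; rewrite -(wh_ep_idl wh x) e (wh_ep_idl wh). Qed.

Let sttM s t : stt (s * t) = stt t * stt s.
Proof.
elim/tens_ind: s => [s s' IH IH'|a b].
  by rewrite mulrDl !(wh_sttD wh) mulrDr -IH -IH'.
elim/tens_ind: t => [t t' IH IH'|c d].
  by rewrite mulrDr !(wh_sttD wh) mulrDl -IH -IH'.
by rewrite tens_mul !sttE tens_mul !stM.
Qed.
Let stt1 : stt (D 1) = D 1. Proof. by rewrite -D_st st1. Qed.

Definition cartan_target : {pred A} := fun x =>
  (D x == D 1 * (x ⊗ 1)) && (D x == (x ⊗ 1) * D 1).
Definition cartan_source : {pred A} := fun x =>
  (D x == D 1 * (1 ⊗ x)) && (D x == (1 ⊗ x) * D 1).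

Lemma targetP x :
  reflect (D x = D 1 * (x ⊗ 1) /\ D x = (x ⊗ 1) * D 1) (x \in cartan_target).
Proof.
apply: (iffP andP) => [[/eqP xl /eqP xr]|[xl xr]]; first exact: conj xl xr.
by split; apply/eqP.
Qed.
Lemma sourceP x :
  reflect (D x = D 1 * (1 ⊗ x) /\ D x = (1 ⊗ x) * D 1) (x \in cartan_source).
Proof.
apply: (iffP andP) => [[/eqP xl /eqP xr]|[xl xr]]; first exact: conj xl xr.
by split; apply/eqP.
Qed.

Lemma target1 : 1 \in cartan_target.
Proof. by apply/targetP; rewrite -[1 ⊗ 1]/(1 : tensor A A) mulr1 mul1r. Qed.
Lemma targetD : {in cartan_target &, forall x y, x + y \in cartan_target}.
Proof.
move=> x y /targetP[xl xr] /targetP[yl yr]; apply/targetP.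
by rewrite linearD tensDl mulrDl mulrDr -xl -xr -yl -yr.
Qed.
Lemma targetZ c : {in cartan_target, forall x, c *: x \in cartan_target}.
Proof.
move=> x /targetP[xl xr]; apply/targetP.
by rewrite linearZ tensZl -scalerAl -scalerAr /= -xl -xr.
Qed.
Lemma targetM : {in cartan_target &, forall x y, x * y \in cartan_target}.
Proof.
move=> x y /targetP[xl xr] /targetP[yl yr]; apply/targetP.
have e : (x ⊗ 1) * (y ⊗ 1) = (x * y) ⊗ 1 :> tensor A A.
  by rewrite tens_mul mulr1.
rewrite -e D_mul; split.
  by rewrite {1}yl mulrA D1r {1}xl mulrA.
by rewrite {1}xr -mulrA D1l {1}yr mulrA.
Qed.
Lemma target_st : {in cartan_target, forall x, st x \in cartan_target}.
Proof.
move=> x /targetP[xl xr]; apply/targetP; rewrite D_st.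
by split; [rewrite {1}xr | rewrite {1}xl]; rewrite sttM stt1 sttE st1.
Qed.
Lemma source_st : {in cartan_source, forall x, st x \in cartan_source}.
Proof.
move=> x /sourceP[xl xr]; apply/sourceP; rewrite D_st.
by split; [rewrite {1}xr | rewrite {1}xl]; rewrite sttM stt1 sttE st1.
Qed.
Lemma target_inv :
  {in cartan_target, forall x, x \is a GRing.unit -> x^-1 \in cartan_target}.
Proof.
move=> x /targetP[xl xr] xu; apply/targetP.
have [e1 e2] : (x ⊗ 1) * (x^-1 ⊗ 1) = 1 :> tensor A A /\
    (x^-1 ⊗ 1) * (x ⊗ 1) = 1 :> tensor A A.
  by rewrite !tens_mul mulrV ?mulVr ?mulr1.
split.
  by rewrite -[LHS]mulr1 -e1 mulrA -(D1r x^-1) -(mulrA _ _ (x ⊗ 1)) -xl -D_mul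
    mulVr.
by rewrite -[LHS]mul1r -e2 -mulrA -(D1l x^-1) (mulrA (x ⊗ 1)) -xr -D_mul mulrV.
Qed.

(** The antipode exchanges the legs of the coproduct, hence the two Cartan
    subalgebras. *)
Lemma ka_target x : x \in cartan_target -> ka x \in cartan_source.
Proof.
case/targetP=> xl xr; apply/sourceP.
have flip_inj := can_inj (@tensor_flipK _ A A).
have k1 : tensor_flip (D 1) = tensor_map ka ka (D 1) by rewrite ka_D ka1.
split; apply: flip_inj; rewrite -ka_D tensor_flip_mul tensor_flipE k1.
  rewrite xr; elim/tens_ind: (D 1) => [s t IHs IHt|a b].
    by rewrite mulrDr !tensor_mapD mulrDl -IHs -IHt.
  by rewrite tens_mul ?mul1r ?mulr1 !tensor_mapE tens_mul ka_mul ?mul1r ?mulr1.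
rewrite xl; elim/tens_ind: (D 1) => [s t IHs IHt|a b].
  by rewrite mulrDl !tensor_mapD mulrDr -IHs -IHt.
by rewrite tens_mul ?mul1r ?mulr1 !tensor_mapE tens_mul ka_mul ?mul1r ?mulr1.
Qed.

Lemma ka_source x : x \in cartan_source -> ka x \in cartan_target.
Proof.
case/sourceP=> xl xr; apply/targetP.
have flip_inj := can_inj (@tensor_flipK _ A A).
have k1 : tensor_flip (D 1) = tensor_map ka ka (D 1) by rewrite ka_D ka1.
split; apply: flip_inj; rewrite -ka_D tensor_flip_mul tensor_flipE k1.
  rewrite xr; elim/tens_ind: (D 1) => [s t IHs IHt|a b].
    by rewrite mulrDr !tensor_mapD mulrDl -IHs -IHt.
  by rewrite tens_mul ?mul1r ?mulr1 !tensor_mapE tens_mul ka_mul ?mul1r ?mulr1.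
rewrite xl; elim/tens_ind: (D 1) => [s t IHs IHt|a b].
  by rewrite mulrDl !tensor_mapD mulrDr -IHs -IHt.
by rewrite tens_mul ?mul1r ?mulr1 !tensor_mapE tens_mul ka_mul ?mul1r ?mulr1.
Qed.

(** Both products have the coproduct [(x ⊗ y) Delta(1)]. *)
Lemma target_source_comm x y : x \in cartan_target -> y \in cartan_source ->
  x * y = y * x.
Proof.
case/targetP=> _ xr /sourceP[_ yr]; apply: D_inj; rewrite !D_mul.
rewrite {1}xr {2}yr -!mulrA !D1l {1}yr {1}xr !mulrA !tens_mul.
by rewrite !mulr1 !mul1r.
Qed.

(** One of the two equations is [D_unit_slice].  The adjoint of that
    equation gives the other one for the adjoint slices, which span the same
    space because [Delta(1)] is self-adjoint. *)
Lemma unit_slice_source i :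
  slice (coord (vbasis {:A}) i) (D 1) \in cartan_source.
Proof.
have uL j := D_unit_slice (wh_D_coassoc wh) (wh_antipode wh) j.
apply/sourceP; split; last exact: uL.
set u := slice _ _.
have -> : u = \sum_(j < \dim {:A}) coord (vbasis {:A}) i (st (vbasis {:A})`_j)
  *:
    st (slice (coord (vbasis {:A}) j) (D 1)).
  have stt_sum I (r : seq I) (F : I -> tensor A A) :
      stt (\sum_(j <- r) F j) = \sum_(j <- r) stt (F j).
    elim/big_rec2: _ => [|j x y _ <-]; last exact: (wh_sttD wh).
    by rewrite -(tens0l A (0 : A)) sttE st0.
  rewrite /u -stt1 {1}(slice_expand (D 1)) stt_sum linear_sum.
  by apply: eq_bigr => j _; rewrite sttE /= sliceE /= stt1.
rewrite tens_sumr linear_sum mulr_sumr; apply: eq_bigr => j _.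
rewrite linearZ /= tensZr -scalerAr; congr (_ *: _).
by rewrite D_st uL sttM stt1 sttE st1.
Qed.

(** Unlike the unit, this tensor has its left legs in the target algebra. *)
Definition kunit := tensor_map ka idfun (D 1).

Lemma target_antipode z : z \in cartan_target -> (ka z ⊗ 1) * D 1
  = (1 ⊗ z) * D 1.
Proof. by case/targetP=> zl _; exact:
  (antipode_unit D_mul ka_mul (wh_antipode wh) zl). Qed.

(** The adjoint of [target_antipode]. *)
Lemma source_antipode s : s \in cartan_source -> D 1 * (s ⊗ 1)
  = D 1 * (1 ⊗ ka s).
Proof.
move=> sS; have zT : st (ka s) \in cartan_target
  by rewrite target_st ?ka_source.
have := target_antipode zT; move/(congr1 stt).
by rewrite !sttM !sttE stt1 st1 stK st_antipodeK.
Qed.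

Let kunitMr (t : tensor A A) z :
  tensor_map ka idfun ((z ⊗ 1) * t)
  = tensor_map ka idfun t * (ka z ⊗ 1).
Proof.
elim/tens_ind: t => [s t IHs IHt|a b];
  first by rewrite mulrDr !tensor_mapD mulrDl -IHs -IHt.
by rewrite tens_mul ?mul1r ?mulr1 !tensor_mapE tens_mul ka_mul ?mul1r ?mulr1.
Qed.
Let kunitMl (t : tensor A A) z :
  tensor_map ka idfun (t * (z ⊗ 1))
  = (ka z ⊗ 1) * tensor_map ka idfun t.
Proof.
elim/tens_ind: t => [s t IHs IHt|a b];
  first by rewrite mulrDl !tensor_mapD mulrDr -IHs -IHt.
by rewrite tens_mul ?mul1r ?mulr1 !tensor_mapE tens_mul ka_mul ?mul1r ?mulr1.
Qed.
Let kunitM2l (t : tensor A A) z :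
  tensor_map ka idfun ((1 ⊗ z) * t)
  = (1 ⊗ z) * tensor_map ka idfun t.
Proof.
elim/tens_ind: t => [s t IHs IHt|a b];
  first by rewrite mulrDr !tensor_mapD mulrDr -IHs -IHt.
by rewrite !(tens_mul, tensor_mapE) /= !mul1r.
Qed.
Let kunitM2r (t : tensor A A) z :
  tensor_map ka idfun (t * (1 ⊗ z))
  = tensor_map ka idfun t * (1 ⊗ z).
Proof.
elim/tens_ind: t => [s t IHs IHt|a b];
  first by rewrite mulrDl !tensor_mapD mulrDl -IHs -IHt.
by rewrite !(tens_mul, tensor_mapE) /= !mulr1.
Qed.

Lemma kunit_twist z : z \in cartan_target -> kunit * (ka (ka z) ⊗ 1)
  = (1 ⊗ z) * kunit.
Proof. by move=> zT; rewrite /kunit -kunitMr target_antipode // kunitM2l. Qed.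

Lemma kunit_comm z : z \in cartan_target -> (z ⊗ 1) * kunit = kunit * (1 ⊗ z).
Proof.
move=> zT; pose s := st (ka (st z)).
have sS : s \in cartan_source.
  by rewrite source_st ?ka_target ?target_st.
have kas : ka s = z by rewrite /s ka_st.
by rewrite /kunit -{1}kas -kunitMl source_antipode // kunitM2r kas.
Qed.

Let epl : scalar ep. Proof. by move=> c x y; rewrite linearP. Qed.

(** [epsilon kappa] is another counit, and a left counit equals a right one. *)
Lemma ep_antipode x : ep (ka x) = ep x.
Proof.
pose ek := fun a => ep (ka a).
have ekl : scalar ek by move=> c a b; rewrite /ek !linearP.
have h1 t : ka (counitl ek t) = counitr ep (tensor_flip (tensor_map ka ka t)).
  elim/tens_ind: t => [s t IHs IHt|a b].
    by rewrite tensor_mapD tensor_flipD counitlD counitrD linearD IHs IHt.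
  rewrite tensor_mapE tensor_flipE (counitlE _ _ ekl) (counitrE _ _ epl).
  by rewrite linearZ.
have h2 t : ep (counitl ek t) = ep (ka (counitr ep t)).
  elim/tens_ind: t => [s t IHs IHt|a b].
    by rewrite counitlD counitrD !linearD IHs IHt.
  by rewrite (counitlE _ _ ekl) (counitrE _ _ epl) !linearZ /= /ek mulrC.
have e : counitl ek (D x) = x.
  by apply: ka_inj; rewrite h1 ka_D tensor_flipK (wh_ep_idr wh).
by rewrite -{2}e h2 (wh_ep_idr wh).
Qed.

Let u i := slice (coord (vbasis {:A}) i) (D 1).
Let v (i : 'I_(\dim {:A})) := (vbasis {:A})`_i.
Let b i := ka (u i).

Let D1E : D 1 = \sum_i u i ⊗ v i. Proof. exact: slice_expand. Qed.

Lemma kunitE : kunit = \sum_i b i ⊗ v i.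
Proof.
rewrite /kunit D1E tensor_map_sum; apply: eq_bigr => i _.
by rewrite tensor_mapE.
Qed.

Let bT i : b i \in cartan_target. Proof. exact/ka_source/unit_slice_source. Qed.

Let counitl_sum (I : Type) (r : seq I) (x y : I -> A) :
  counitl ep (\sum_(i <- r) x i ⊗ y i) = \sum_(i <- r) ep (x i) *: y i.
Proof.
elim: r => [|i r IH].
  by rewrite !big_nil -(tens0l A (0 : A)) (counitlE _ _ epl) scaler0.
by rewrite !big_cons counitlD IH (counitlE _ _ epl).
Qed.

Let counitr_sum (I : Type) (r : seq I) (x y : I -> A) :
  counitr ep (\sum_(i <- r) x i ⊗ y i) = \sum_(i <- r) ep (y i) *: x i.
Proof.
elim: r => [|i r IH].
  by rewrite !big_nil -(tens0l A (0 : A)) (counitrE _ _ epl) scaler0.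
by rewrite !big_cons counitrD IH (counitrE _ _ epl).
Qed.

(** Here and in [ka_repro] the counit is applied to one leg of an identity that
    involves the unit: [Delta(z) = Delta(1) (z ⊗ 1)], respectively
    [target_antipode]. *)
Lemma target_repro z : z \in cartan_target -> z = \sum_i ep (u i * z) *: v i.
Proof.
case/targetP=> zl _; rewrite -{1}(wh_ep_idl wh z) zl D1E mulr_suml.
under eq_bigr => i _ do rewrite tens_mul mulr1.
exact: counitl_sum.
Qed.

Lemma ka_repro z : z \in cartan_target -> ka z = \sum_i ep (z * v i) *: u i.
Proof.
move=> zT; have := congr1 (counitr ep) (target_antipode zT).
rewrite D1E !mulr_sumr.
under eq_bigr => i _ do rewrite tens_mul mul1r.
under [in RHS]eq_bigr => i _ do rewrite tens_mul mul1r.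
rewrite !counitr_sum => <-.
under eq_bigr => i _ do rewrite scalerAr.
by rewrite -mulr_sumr -counitr_sum -D1E (wh_ep_idr wh) mulr1.
Qed.

(** Both sides are [sum epsilon(z v_i) epsilon(u_i w)]. *)
Lemma ep_ka_target z w : z \in cartan_target -> w \in cartan_target ->
  ep (ka z * w) = ep (z * w).
Proof.
move=> zT wT; rewrite (ka_repro zT) [in RHS](target_repro wT).
rewrite mulr_suml mulr_sumr !linear_sum; apply: eq_bigr => i _.
by rewrite -scalerAl -scalerAr !linearZ /= mulrC.
Qed.

(** As [epsilon(kappa(z) w) = epsilon(z w)] on the target algebra,
    [target_repro] also holds with the left legs of [kunit]. *)
Lemma kunit_dual z : z \in cartan_target -> z = \sum_i ep (z * b i) *: v i.
Proof.
move=> zT; rewrite {1}(target_repro zT); apply: eq_bigr => i _.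
by rewrite -(ep_ka_target zT (bT i)) -ka_mul ep_antipode.
Qed.

(** A null vector [y] is orthogonal to everything, so that [kunit_dual]
    reproduces [y^*] as zero. *)
Lemma ep_faithful : {in cartan_target, forall y, ep (st y * y) = 0 -> y = 0}.
Proof.
move=> y yT y0; apply: (can_inj stK); rewrite st0.
rewrite (kunit_dual (target_st yT)) big1 // => i _.
by rewrite (form_null st_conj (wh_ep_ge0 wh) _ y0) scale0r.
Qed.

(** Expanding the left legs of [kunit] in an orthonormal family [X] leaves at
    [f] the right leg [sum epsilon(f^* b_i) v_i], which is [f^*] by duality. *)
Lemma kunit_orthonormal : exists X : seq A,
  [/\ {subset X <= cartan_target},
      kunit = \sum_(f <- X) f ⊗ st f &
      1 = \sum_(f <- X) ep f *: st f].
Proof.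
have [|X XT Xb] := gram_schmidt st_conj (wh_ep_ge0 wh) target1
   targetD targetZ ep_faithful (s := [seq b i | i <- enum 'I_(\dim {:A})]).
  by move=> _ /mapP[i _ ->].
have bE i : b i = \sum_(f <- X) ep (st f * b i) *: f.
  by apply: Xb; rewrite map_f ?mem_enum.
have kX : kunit = \sum_(f <- X) f ⊗ st f.
  rewrite kunitE.
  under eq_bigr => i _ do rewrite bE tens_suml.
  rewrite exchange_big /= big_seq [RHS]big_seq; apply: eq_bigr => f fX.
  rewrite [in RHS](kunit_dual (target_st (XT f fX))) tens_sumr.
  by apply: eq_bigr => i _; rewrite tensZl tensZr.
exists X; split=> //; rewrite {1}(kunit_dual target1).
under eq_bigr => i _ do rewrite mul1r.
transitivity (counitl ep kunit); first by rewrite kunitE counitl_sum.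
by rewrite kX counitl_sum.
Qed.

End StarWeakHopf.

(** * The canonical element *)

Section CanonicalElement.
Context (C : numClosedFieldType) (A : falgType C).
Context (st : A -> A) (stt : tensor A A -> tensor A A).
Context (D : {linear A -> tensor A A}) (ka : {linear A -> A}) (ep : {scalar A}).
Hypothesis wh : star_weak_hopf st stt D ka ep.

Let T := cartan_target D.
Let st_conj := wh_st_conj wh.
Let stK := wh_stK wh.
Let stM := wh_st_mul wh.
Let st1 : st 1 = 1 := invol1 stK stM.

Variable X : seq A.
Hypothesis XT : {subset X <= T}.
Hypothesis kX : kunit D ka = \sum_(f <- X) f ⊗ st f.
Hypothesis X1 : 1 = \sum_(f <- X) ep f *: st f.

(** The product of the legs of [kunit] in the reverse order. *)
Definition canonical_element := \sum_(f <- X) st f * f.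
Let q := canonical_element.

Lemma legs_separate z : {in X, forall f, st f * z = 0} -> z = 0.
Proof.
move=> Xz; rewrite -[z]mul1r X1 mulr_suml big_seq big1 // => f fX.
by rewrite -scalerAl Xz // scaler0.
Qed.

Lemma legs_separate_star z : {in X, forall f, f * z = 0} -> z = 0.
Proof.
move=> Xz; rewrite -[z]mul1r -st1 X1 (invol_sum st_conj) mulr_suml big_seq.
rewrite big1 // => f fX.
by rewrite (invol_scale st_conj) stK -scalerAl Xz // scaler0.
Qed.

Lemma canonical_target : q \in T.
Proof.
rewrite /q /canonical_element big_seq.
apply: (big_ind (fun x => x \in T)) => [||f fX].
- exact: (subalg0 (target1 _) (targetZ (D := D))).
- exact: targetD.
- by apply: (targetM wh); [apply: (target_st wh)|]; apply: XT.
Qed.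

Lemma canonical_star : st q = q.
Proof.
rewrite /q /canonical_element (invol_sum st_conj); apply: eq_bigr => f _.
by rewrite stM stK.
Qed.

Lemma canonical_root : exists c, [/\ c \in T /\ c^-1 \in T, c \is a GRing.unit,
  st c = c, c * c = q & forall x, x * q = q * x -> x * c = c * x].
Proof.
apply: (positive_root st_conj stK stM (wh_ep_ge0 wh) (target1 _)
  (@targetD _ _ D)
  (@targetZ _ _ D) (targetM wh) (ep_faithful wh) canonical_target
    canonical_star).
apply: (squares_positive stM (wh_ep_ge0 wh) (targetM wh) (ep_faithful wh) XT).
exact: legs_separate_star.
Qed.

(** [kunit_twist], after multiplying the right leg by the left one. *)
Lemma canonical_twist z : z \in T -> q * ka (ka z) = z * q.
Proof.
move=> zT; pose M (t : tensor A A) := mul_map idfun (tensor_flip t).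
have idl : linear (@idfun A) by [].
have ML t x : M ((1 ⊗ x) * t) = x * M t.
  rewrite /M; elim/tens_ind: t => [s t IHs IHt|a b].
    by rewrite mulrDr !tensor_flipD !mul_mapD IHs IHt mulrDr.
  by rewrite tens_mul mul1r !tensor_flipE !(mul_mapE _ _ idl) /= mulrA.
have MR t x : M (t * (x ⊗ 1)) = M t * x.
  rewrite /M; elim/tens_ind: t => [s t IHs IHt|a b].
    by rewrite mulrDl !tensor_flipD !mul_mapD IHs IHt mulrDl.
  by rewrite tens_mul mulr1 !tensor_flipE !(mul_mapE _ _ idl) /= mulrA.
have Mq : M (kunit D ka) = q.
  rewrite kX /q /canonical_element; elim: (X) => [|f s IH].
    rewrite !big_nil -(tens0l A (0 : A)) /M tensor_flipE.
    by rewrite (mul_mapE _ _ idl) mulr0.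
  have MD t t' : M (t + t') = M t + M t' by rewrite /M tensor_flipD mul_mapD.
  by rewrite !big_cons MD IH /M tensor_flipE (mul_mapE _ _ idl).
by have := congr1 M (kunit_twist wh zT); rewrite ML MR Mq.
Qed.

(** [kunit] is [sum f ⊗ f^*] while [q] is [sum f^* f]: the factor [f^*] is
    moved to the right leg of the Casimir element of the matrix units, where it
    recreates [kunit], through which the matrix units pass by [kunit_comm]. *)
Lemma canonical_casimir (e : matrix_family A) :
  (forall g, (0 < bsize e g)%N) ->
  (forall g i j, munit e g i j \in T) ->
  (forall g i j k l, munit e g i j * munit e g k l
     = if j == k then munit e g i l else 0) ->
  (forall g h i j k l, g != h -> munit e g i j * munit e h k l = 0) ->
  \sum_g \sum_i munit e g i i = 1 ->
  {in T, forall x, exists c : forall g, 'I_(bsize e g) -> 'I_(bsize e g) -> C,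
     x = \sum_g \sum_i \sum_j c g i j *: munit e g i j} ->
  kunit D ka = \sum_g \sum_i \sum_j
    (bsize e g)%:R^-1 *: ((munit e g i j * q) ⊗ munit e g j i).
Proof.
move=> e_pos eT e_mul e_orth e_one e_span.
pose Cl w : tensor A A := \sum_g \sum_i \sum_j
  (bsize e g)%:R^-1 *: ((munit e g i j * w) ⊗ munit e g j i).
pose Cr w : tensor A A := \sum_g \sum_i \sum_j
  (bsize e g)%:R^-1 *: (munit e g i j ⊗ (w * munit e g j i)).
have ClL : linear Cl.
  move=> c x y; rewrite /Cl scaler_sumr -big_split; apply: eq_bigr => g _ /=.
  rewrite scaler_sumr -big_split; apply: eq_bigr => i _ /=.
  rewrite scaler_sumr -big_split; apply: eq_bigr => j _ /=.
  by rewrite mulrDr -scalerAr tensDl tensZl scalerDr !scalerA mulrC.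
have CrL : linear Cr.
  move=> c x y; rewrite /Cr scaler_sumr -big_split; apply: eq_bigr => g _ /=.
  rewrite scaler_sumr -big_split; apply: eq_bigr => i _ /=.
  rewrite scaler_sumr -big_split; apply: eq_bigr => j _ /=.
  by rewrite mulrDl -scalerAl tensDr tensZr scalerDr !scalerA mulrC.
pose cl : {linear A -> tensor A A} :=
  HB.pack Cl (GRing.isLinear.Build _ _ _ _ Cl ClL).
pose cr : {linear A -> tensor A A} :=
  HB.pack Cr (GRing.isLinear.Build _ _ _ _ Cr CrL).
(* both sides send a matrix unit [e_kl] to the sum of the [e_il ⊗ e_ki] *)
have casimir w : w \in T -> Cl w = Cr w.
  move=> /e_span[c ->]; rewrite -[LHS]/(cl _) -[RHS]/(cr _) !linear_sum.
  apply: eq_bigr => h _; rewrite !linear_sum; apply: eq_bigr => k _.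
  rewrite !linear_sum; apply: eq_bigr => l _; rewrite !linearZ; congr (_ *: _).
  rewrite /= /Cl /Cr (bigD1 h) //= [in RHS](bigD1 h) //=.
  rewrite [X in _ + X = _]big1 => [|g gh]; last first.
    by rewrite big1 // => i _; rewrite big1 // => j _;
      rewrite e_orth // tens0l scaler0.
  rewrite [X in _ = _ + X]big1 => [|g gh]; last first.
    rewrite big1 // => i _; rewrite big1 // => j _.
    by rewrite e_orth 1?eq_sym // tens0r scaler0.
  congr (_ + _); apply: eq_bigr => i _.
  rewrite (bigD1 k) //= big1 => [|j jk]; last first.
    by rewrite e_mul (negPf jk) tens0l scaler0.
  rewrite [in RHS](bigD1 l) //= [X in _ = _ + X]big1 => [|j jl]; last first.
    by rewrite e_mul eq_sym (negPf jl) tens0r scaler0.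
  by rewrite !e_mul !eqxx.
have step : Cl q = \sum_(f <- X) Cl (st f) * (f ⊗ 1).
  rewrite -[LHS]/(cl _) linear_sum; apply: eq_bigr => f _.
  rewrite /= /Cl mulr_suml; apply: eq_bigr => g _; rewrite mulr_suml.
  apply: eq_bigr => i _; rewrite mulr_suml; apply: eq_bigr => j _.
  by rewrite -scalerAl tens_mul mulr1 mulrA.
rewrite -/(Cl q) step big_seq.
under eq_bigr => f fX do rewrite casimir ?(target_st wh) ?XT //.
rewrite -big_seq /Cr.
under eq_bigr => f _ do rewrite mulr_suml.
rewrite exchange_big /=.
transitivity (\sum_g kunit D ka * (1 ⊗ \sum_i munit e g i i)).
  by rewrite -mulr_sumr -tens_sumr e_one -[1 ⊗ 1]/(1 : tensor A A) mulr1.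
apply: eq_bigr => g _.
under [in RHS]eq_bigr => f _ do rewrite mulr_suml.
rewrite exchange_big /= tens_sumr mulr_sumr; apply: eq_bigr => i _.
under [in RHS]eq_bigr => f _ do rewrite mulr_suml.
rewrite exchange_big /=.
have n0 : (bsize e g)%:R != 0 :> C by rewrite pnatr_eq0 -lt0n.
transitivity (\sum_(j < bsize e g) (bsize e g)%:R^-1 *:
  (kunit D ka * (1 ⊗ munit e g i i))).
  rewrite sumr_const card_ord -scaler_nat scalerA mulfV //.
  by rewrite scale1r.
apply: eq_bigr => j _.
have -> : kunit D ka * (1 ⊗ munit e g i i)
    = (munit e g i j ⊗ 1) * kunit D ka * (1 ⊗ munit e g j i).
  rewrite (kunit_comm wh (eT g i j)) -mulrA tens_mul mulr1 e_mul eqxx.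
  by [].
rewrite kX mulr_sumr mulr_suml scaler_sumr; apply: eq_bigr => f _.
by rewrite -scalerAl !tens_mul mul1r !mulr1.
Qed.

Section Casimir.
Variable e : matrix_family A.
Hypothesis eE : kunit D ka = \sum_g \sum_i \sum_j
    (bsize e g)%:R^-1 *: ((munit e g i j * q) ⊗ munit e g j i).

Lemma unit_casimir : D 1 = \sum_g \sum_i \sum_j
    (bsize e g)%:R^-1 *:
      ((linfun ka)^-1%VF (munit e g i j * q) ⊗ munit e g j i).
Proof.
have inv_ka a : (linfun ka)^-1%VF (ka a) = a.
  have := @lker0_lfunK _ _ _ (linfun ka) _ a; rewrite lfunE; apply.
  by apply/lker0P => x y; rewrite !lfunE; apply: (ka_inj wh).
have -> : D 1 = tensor_map (linfun ka)^-1%VF idfun (kunit D ka).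
  rewrite /kunit; elim/tens_ind: (D 1) => [s t IHs IHt|a b].
    by rewrite !tensor_mapD -IHs -IHt.
  by rewrite !tensor_mapE /= inv_ka.
rewrite eE tensor_map_sum; apply: eq_bigr => g _.
rewrite tensor_map_sum; apply: eq_bigr => i _.
rewrite tensor_map_sum; apply: eq_bigr => j _.
by rewrite -tensZl tensor_mapE linearZ tensZl.
Qed.

Lemma contraction_casimir z : contraction idfun z (kunit D ka) =
  \sum_g \sum_i \sum_j
    (bsize e g)%:R^-1 *: (munit e g i j * (q * z) * munit e g j i).
Proof.
have idl : linear (@idfun A) by [].
rewrite eE contraction_sum; apply: eq_bigr => g _.
rewrite contraction_sum; apply: eq_bigr => i _.
rewrite contraction_sum; apply: eq_bigr => j _.
by rewrite contractionZ (contractionE _ _ _ idl) !mulrA.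
Qed.

End Casimir.

(** * Elements deforming the antipode *)

(** The target algebra contains a projection that commutes with [q] and is not
    central: a spectral projection of [q] or, if [q] is central, of any
    non-central self-adjoint element. *)
Lemma noncentral_projection : ~ {in T &, forall x y, x * y = y * x} ->
  exists p y, [/\ p \in T, st p = p, p * p = p, p * q = q * p &
                  y \in T /\ p * y <> y * p].
Proof.
move=> nab.
suff [g [y [gT gst gq yT gy]]] : exists g y,
    [/\ g \in T, st g = g, g * q = q * g, y \in T & g * y <> y * g].
  have [p [pT pst pp pcomm py]] := noncommuting_projection st_conj stK stM
    (target1 _) (@targetD _ _ D) (@targetZ _ _ D) (targetM wh) (ep_faithful wh)
    gT gst gy.
  by exists p, y; split=> //; apply/esym/pcomm/esym.
have [qc|/existsNP[y /not_implyP[yT qy]]] :=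
    EM (forall y, y \in T -> q * y = y * q); last first.
  by exists q, y; split=> //; [exact: canonical_target | exact: canonical_star].
have [x [y [xT yT xy]]] : exists x y, [/\ x \in T, y \in T & x * y <> y * x].
  apply: contra_notP nab => /forallNP h x y xT yT;
    apply: contra_notP (h x) => xy.
  by exists y.
have stT := target_st wh xT.
pose g1 := x + st x; pose g2 := 'i *: (x - st x).
have g1T : g1 \in T by rewrite targetD.
have g2T : g2 \in T by rewrite targetZ // targetD // -scaleN1r targetZ.
have g1st : st g1 = g1 by rewrite (invol_add st_conj) stK addrC.
have g2st : st g2 = g2.
  rewrite (invol_scale st_conj) (invol_add st_conj) -scaleN1r.
  rewrite (invol_scale st_conj) stK rmorphN1 scaleN1r conjCi scaleNr -scalerN.
  by rewrite opprB.
have [c1|c1] := EM (g1 * y = y * g1); last by exists g1, y; split=> //;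
  rewrite qc.
exists g2, y; split=> //; first by rewrite qc.
move=> c2; apply: xy; apply: (scalerI (_ : 2%:R != 0 :> C)).
  by rewrite pnatr_eq0.
have -> : 2%:R *: (x * y) = (2%:R *: x) * y by rewrite scalerAl.
have -> : 2%:R *: (y * x) = y * (2%:R *: x) by rewrite scalerAr.
have -> : 2%:R *: x = g1 + (- 'i) *: g2.
  rewrite /g1 /g2 scalerA mulNr -expr2 sqrCi opprK scale1r addrACA subrr addr0.
  by rewrite scaler_nat mulr2n.
by rewrite mulrDl mulrDr c1 -scalerAl -scalerAr c2.
Qed.

(** A self-adjoint idempotent that is not central has a nonzero off-diagonal
    corner; the involution exchanges the two such corners. *)
Lemma offdiagonal_corner p y : p \in T -> st p = p -> p * p = p ->
  y \in T -> p * y <> y * p ->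
  exists x, [/\ x \in T, x != 0, p * x = 0 & x * p = x].
Proof.
move=> pT p_star pp yT py; pose c w := w * p - p * w * p.
have cP w : w \in T -> [/\ c w \in T, p * c w = 0 & c w * p = c w].
  move=> wT; split.
  - rewrite /c -scaleN1r; apply: (targetD (D := D)); last apply: targetZ.
      exact: (targetM wh).
    by apply: (targetM wh) => //; apply: (targetM wh).
  - by rewrite mulrBr !mulrA pp subrr.
  - by rewrite /c mulrBl -!mulrA pp.
have [c0|c0] := eqVneq (c y) 0; last by have [? ? ?] := cP y yT; exists (c y).
have [c0'|c0'] := eqVneq (c (st y)) 0; last first.
  by have [? ? ?] := cP (st y) (target_st wh yT); exists (c (st y)).
case: py; move/eqP: c0; rewrite subr_eq0 => /eqP ->.
move/eqP: c0'; rewrite subr_eq0 => /eqP h.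
by apply: (can_inj stK); rewrite !stM p_star h !mulrA pp.
Qed.

Variables (r : C) (p : A).
Hypotheses (r_gt0 : 0 < r) (pT : p \in T) (p_star : st p = p) (pp : p * p = p).
Hypothesis pq : p * q = q * p.

(** It multiplies the image of [p] by [1 + r] and fixes its kernel. *)
Definition dilation := 1 + r *: p.

(* [v] is the square root of the dilation, and [v'] its inverse *)
Let t := sqrtC (1 + r).
Let v := 1 + (t - 1) *: p.
Let v' := 1 + (t^-1 - 1) *: p.

Let t_gt0 : 0 < t. Proof. by rewrite sqrtC_gt0 addr_gt0. Qed.

Let affine_mul a b : (1 + a *: p) * (1 + b *: p) = 1 + (a + b + a * b) *: p.
Proof.
rewrite mulrDl mul1r mulrDr mulr1 -scalerAl -scalerAr pp scalerA -!addrA.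
by congr (_ + _); rewrite -!scalerDl; congr (_ *: _); rewrite addrCA addrA.
Qed.

Let affine_target a : 1 + a *: p \in T.
Proof. by rewrite targetD ?target1 ?targetZ. Qed.

Let vv : v * v = dilation.
Proof.
rewrite /v affine_mul /dilation; congr (_ + _ *: _).
have -> : t - 1 + (t - 1) + (t - 1) * (t - 1) = t ^+ 2 - 1 by ring.
by rewrite /t sqrtCK addrC addKr.
Qed.

Let vv' : v * v' = 1.
Proof.
rewrite affine_mul -[RHS]addr0; congr (_ + _).
have t0 : t != 0 by rewrite gt_eqF.
have -> : t - 1 + (t^-1 - 1) + (t - 1) * (t^-1 - 1) = 0 by field.
by rewrite scale0r.
Qed.

Let v'v : v' * v = 1.
Proof. by rewrite -[RHS]vv' /v /v' !affine_mul [t - 1 + _]addrC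
  [_ * (_ - 1)]mulrC. Qed.

Let v_unit : v \is a GRing.unit. Proof. by apply/unitrP; exists v'. Qed.
Let v_star : st v = v.
Proof.
rewrite /v (invol_add st_conj) st1 (invol_scale st_conj) p_star conj_Creal //.
by rewrite rpredB ?rpred1 ?gtr0_real.
Qed.

Lemma dilation_unit : dilation \is a GRing.unit.
Proof. by rewrite -vv unitrMl. Qed.

(** The element is [k = z q u^-1], where [u = 1 + r p] commutes with [q] and
    the central factor [z] restores the normalisation.  As [q], [u] and [z]
    are squares of commuting self-adjoint elements, so is [k]. *)
Lemma deforming_element : exists k y,
  [/\ k \in T, k = st y * y /\ y \is a GRing.unit,
      ka (ka k) = k /\ k * q = q * k,
      contraction idfun k^-1 (kunit D ka) = 1 &
      {in T, forall x, k * ka (ka x) * k^-1 = dilation^-1 * x * dilation}].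
Proof.
have [c [[cT c'T] cu cst cc c_comm]] := canonical_root.
have pc : p * c = c * p by apply: c_comm.
have vc : GRing.comm v c.
  by rewrite /GRing.comm /v mulrDl mulrDr mul1r mulr1 -scalerAl -scalerAr pc.
(* [x] is a square root of [u q^-1], hidden behind an equation to keep
   [mulrA] from unfolding it *)
have [x xE] : exists x, x = v * c^-1 by exists (v * c^-1).
have vc' : GRing.comm v c^-1 by apply: commrV.
have xT : x \in T by rewrite xE (targetM wh) ?affine_target.
have xu : x \is a GRing.unit by rewrite xE unitrMl ?unitrV.
have x_star : st x = x by rewrite xE stM (invol_inv stK stM) // cst v_star -vc'.
(* the expectation of [u q^-1] is the sum of the squares of [Y] *)
pose Y := [seq st (f * x) | f <- X].
have YT : {subset Y <= T}.
  move=> _ /mapP[f fX ->]; apply: (target_st wh); apply: (targetM wh) => //.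
  exact: XT.
have Y_sep z : {in Y, forall y, y * z = 0} -> z = 0.
  move=> Yz; apply: legs_separate => f fX; apply: (mulrI xu).
  rewrite mulr0 mulrA -{1}x_star -stM; apply: Yz.
  by apply/mapP; exists f.
pose z := \sum_(y <- Y) st y * y.
have contraction_kunit K :
    contraction idfun K (kunit D ka) = \sum_(f <- X) f * K * st f.
  have idl : linear (@idfun A) by [].
  rewrite kX; elim: (X) => [|f s IH].
    by rewrite !big_nil -(tens0l A (0 : A)) (contractionE _ _ _ idl) mulr0.
  by rewrite !big_cons contractionD IH (contractionE _ _ _ idl).
have zE : z = \sum_(f <- X) f * (x * x) * st f.
  rewrite /z big_map; apply: eq_bigr => f _.
  by rewrite stK stM x_star !mulrA.
have z_comm w : w \in T -> w * z = z * w.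
  move=> wT; rewrite zE -contraction_kunit.
  have idl : linear (@idfun A) by [].
  have CL s :
      contraction idfun (x * x) ((w ⊗ 1) * s) = w * contraction idfun (x * x) s.
    elim/tens_ind: s => [s s' IH IH'|a b].
      by rewrite mulrDr !contractionD mulrDr IH IH'.
    by rewrite tens_mul mul1r !(contractionE _ _ _ idl) /= !mulrA.
  have CR s :
      contraction idfun (x * x) (s * (1 ⊗ w)) = contraction idfun (x * x) s * w.
    elim/tens_ind: s => [s s' IH IH'|a b].
      by rewrite mulrDl !contractionD mulrDl IH IH'.
    by rewrite tens_mul mulr1 !(contractionE _ _ _ idl) /= !mulrA.
  by rewrite -CL (kunit_comm wh wT) CR.
have zT : z \in T.
  rewrite /z big_seq; apply: (big_ind (fun x => x \in T)) => [||y yY].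
  - exact: (subalg0 (target1 _) (targetZ (D := D))).
  - exact: targetD.
  - by apply: (targetM wh); [apply: (target_st wh)|]; apply: YT.
have z_star : st z = z.
  rewrite /z (invol_sum st_conj); apply: eq_bigr => y _.
  by rewrite stM stK.
have [e [[eT e'T] eu est ee e_comm]] := positive_root st_conj stK stM
  (wh_ep_ge0 wh) (target1 _) (@targetD _ _ D) (@targetZ _ _ D) (targetM wh)
  (ep_faithful wh) zT z_star (squares_positive stM (wh_ep_ge0 wh) (targetM wh)
  (ep_faithful wh) YT Y_sep).
have eC w : w \in T -> GRing.comm e w.
  by move=> wT; apply/commr_sym/e_comm/z_comm.
pose y := x^-1 * e.
have [k kyy] : exists k, k = y * y by exists (y * y).
have xe : GRing.comm x^-1 e by apply/commr_sym/commrV/eC.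
have yu : y \is a GRing.unit by rewrite unitrMl ?unitrV.
have y_star : st y = y by rewrite stM est (invol_inv stK stM) // x_star -xe.
have yT : y \in T by rewrite (targetM wh) ?(target_inv wh).
have kT : k \in T by rewrite kyy (targetM wh).
have ku : k \is a GRing.unit by rewrite kyy unitrMl.
have xc : GRing.comm x c.
  by rewrite xE; apply/commr_sym/commrM;
    [apply/commr_sym | apply/commrV/commr_refl].
have yc : GRing.comm y c.
  by apply/commr_sym/commrM; [apply/commrV/commr_sym | apply/commr_sym/eC].
have kq : k * q = q * k.
  have kc : GRing.comm k c by rewrite kyy; apply/commr_sym/commrM;
    apply/commr_sym.
  by rewrite -cc; apply: commrM.
have qu : q \is a GRing.unit by rewrite -cc unitrMl.
have zu : z \is a GRing.unit by rewrite -ee unitrMl.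
have qx : GRing.comm q x^-1.
  by apply/commrV; rewrite -cc; apply/commr_sym/commrM.
have kE : k = x^-1 * x^-1 * z.
  by rewrite kyy /y mulrA -(mulrA x^-1 e) -xe -ee !mulrA.
have uE : dilation = x * x * q.
  have xv : v = x * c by rewrite xE -mulrA mulVr ?mulr1.
  by rewrite -vv xv mulrA -(mulrA x c) -xc -cc !mulrA.
have uk : dilation * k = z * q.
  rewrite uE kE !mulrA -(mulrA (x * x) q) qx !mulrA -(mulrA x x) mulrV // mulr1.
  by rewrite -(mulrA x q) qx mulrA mulrV // mul1r z_comm ?canonical_target.
have kV : k^-1 = z^-1 * (x * x).
  apply: (mulrI ku); rewrite mulrV // kE -mulrA (mulrA z) mulrV // mul1r.
  by rewrite mulrA -(mulrA x^-1) mulVr // mulr1 mulVr.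
exists k, y; split=> //; first by rewrite y_star.
- split=> //; apply: (mulrI qu).
  by rewrite (canonical_twist kT) kq.
- rewrite contraction_kunit kV -[RHS](mulVr zu) [X in _ = _ * X]zE mulr_sumr.
  rewrite big_seq [RHS]big_seq; apply: eq_bigr => f fX.
  have fz : GRing.comm f z^-1 by apply: commrV; exact/z_comm/XT.
  by rewrite !mulrA fz.
- move=> w wT; apply: (mulrI dilation_unit);
  rewrite !mulrA uk mulrV ?dilation_unit // mul1r.
  rewrite -(mulrA z) canonical_twist // mulrA -z_comm // -(mulrA w) -uk.
  by rewrite !mulrA mulrK.
Qed.

End CanonicalElement.

(** * Conjugation by a dilation *)

Section Corners.
Context (C : numClosedFieldType) (A : falgType C).
Implicit Types (p x y : A) (r : C).

Lemma dilation_eigenvector r p x : dilation r p \is a GRing.unit ->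
  p * x = 0 -> x * p = x -> (dilation r p)^-1 * x * dilation r p = (1 + r) *: x.
Proof.
move=> uu px xp; apply: (mulrI uu); rewrite !mulrA mulrV // mul1r.
rewrite -scalerAr /dilation mulrDl mulrDr mul1r mulr1 -scalerAl -scalerAr px xp.
by rewrite scaler0 addr0 scalerDl scale1r.
Qed.

(** On the four corners cut out by [p], conjugation by [1 + r p] has the
    eigenvalues [1], [1], [1 + r] and [(1 + r)^-1]; only one exceeds [1]. *)
Lemma dilation_eigenvalue r r' p x : p * p = p -> 0 < r -> 0 < r' -> x != 0 ->
  x * dilation r' p = (1 + r) *: (dilation r' p * x) -> r = r'.
Proof.
move=> pp r0 r'0 x0 xu.
have corner c d g h : c * p = g *: c -> p * d = h *: d ->
    1 + r' * h - (1 + r) * (1 + r' * g) != 0 -> c * x * d = 0.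
  move=> cp pd n0; apply: (scalerI n0); rewrite scaler0 scalerBl.
  apply/eqP; rewrite subr_eq0; apply/eqP.
  have ud : dilation r' p * d = (1 + r' * h) *: d.
    by rewrite /dilation mulrDl mul1r -scalerAl pd scalerA scalerDl scale1r.
  have cu : c * dilation r' p = (1 + r' * g) *: c.
    by rewrite /dilation mulrDr mulr1 -scalerAr cp scalerA scalerDl scale1r.
  by rewrite scalerAr -ud mulrA -(mulrA c x (dilation r' p)) xu -scalerAr mulrA
    cu -!scalerAl scalerA.
have p1 : p * (1 - p) = 0 *: (1 - p) by rewrite scale0r mulrBr mulr1 pp subrr.
have p1' : (1 - p) * p = 0 *: (1 - p) by rewrite scale0r mulrBl mul1r pp subrr.
have p2 : p * p = 1 *: p by rewrite scale1r.
have neg z : 0 < z -> - z != 0 by move=> z0; rewrite oppr_eq0 gt_eqF.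
apply/eqP/negPn/negP => rr'; case/negP: x0; apply/eqP.
have -> : x = p * x * p + p * x * (1 - p) +
  ((1 - p) * x * p + (1 - p) * x * (1 - p)).
  have e1 : p + (1 - p) = 1 by rewrite addrC subrK.
  by rewrite -!mulrDr e1 !mulr1 -mulrDl e1 mul1r.
rewrite (corner _ _ _ _ p2 p2) ?(corner _ _ _ _ p2 p1) ?(corner _ _ _ _ p1' p2)
  ?(corner _ _ _ _ p1' p1) ?addr0 //.
- have -> : 1 + r' * 0 - (1 + r) * (1 + r' * 0) = - r by ring.
  exact: neg.
- have -> : 1 + r' * 1 - (1 + r) * (1 + r' * 0) = r' - r by ring.
  by rewrite subr_eq0 eq_sym.
- have -> : 1 + r' * 0 - (1 + r) * (1 + r' * 1) = - (r + r' + r * r') by ring.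
  by rewrite neg // !addr_gt0 ?mulr_gt0.
- have -> : 1 + r' * 1 - (1 + r) * (1 + r' * 1) = - (r + r * r') by ring.
  by rewrite neg // addr_gt0 ?mulr_gt0.
Qed.

End Corners.

(** * Involution, antipode and Cartan subalgebras of a deformation *)

Section DeformedStar.
Context (C : numClosedFieldType) (A : falgType C).
Context (st : A -> A) (stt : tensor A A -> tensor A A).
Context (D : {linear A -> tensor A A}) (ka : {linear A -> A}) (ep : {scalar A}).
Hypothesis wh : star_weak_hopf st stt D ka ep.

Let st_conj := wh_st_conj wh.
Let stK := wh_stK wh.
Let stM := wh_st_mul wh.

Variables k y : A.
Hypotheses (kT : k \in cartan_target D) (kE : k = st y * y).
Hypotheses (yu : y \is a GRing.unit) (kak : ka (ka k) = k).

Let k_star : st k = k. Proof. by rewrite kE stM stK. Qed.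
Let ku : k \is a GRing.unit. Proof. by rewrite kE unitrMl // invol_unit. Qed.
Let kV_star : st k^-1 = k^-1. Proof.
  by rewrite (invol_inv stK stM) // k_star. Qed.

Let st' x := k * st x * k^-1.
Let ka' x := k * ka x * k^-1.

Lemma deformed_st_conj c a b : st' (c *: a + b) = c^* *: st' a + st' b.
Proof. by rewrite /st' st_conj mulrDr mulrDl -scalerAr -scalerAl. Qed.

Lemma deformed_stK : involutive st'.
Proof.
move=> x; rewrite /st' !stM k_star kV_star stK.
by rewrite !mulrA mulrV // mul1r mulrK.
Qed.

Lemma deformed_st_mul a b : st' (a * b) = st' b * st' a.
Proof. by rewrite /st' stM !mulrA mulrVK. Qed.

(** The deformed involution is the original one transported by an inner
    automorphism, hence the norm of the deformed algebra. *)
Definition untwist x := (st y)^-1 * x * st y.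

Lemma untwistM a b : untwist (a * b) = untwist a * untwist b.
Proof. by rewrite /untwist !mulrA mulrK ?invol_unit. Qed.

Lemma untwist_star x : untwist (st' x) = st (untwist x).
Proof.
have su : st y \is a GRing.unit by rewrite invol_unit.
rewrite /untwist /st' !stM stK (invol_inv stK stM) // stK kE invrM // !mulrA.
by rewrite mulVr // mul1r mulrVK.
Qed.

Lemma untwist_inj x : untwist x = 0 -> x = 0.
Proof.
have su : st y \is a GRing.unit by rewrite invol_unit.
move=> e; apply: (mulIr su); apply: (mulrI (_ : (st y)^-1 \is a GRing.unit)).
  by rewrite unitrV.
by rewrite mulrA mul0r mulr0.
Qed.

(** The composite of the deformed antipode and involution is the original one
    conjugated by [g = k kappa(k)^-1], and [kappa] sends [g^*] to [g^-1]. *)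
Lemma deformed_antipode_star x : ka' (st' (ka' (st' x))) = x.
Proof.
have [kku kkV] := kaV wh ku.
have kst : st (ka k) = ka k.
  by apply: (ka_inj wh); rewrite kak -{1}k_star (wh_ka_st wh).
have [g gE] : exists g, g = k * (ka k)^-1 by exists (k * (ka k)^-1).
have gu : g \is a GRing.unit by rewrite gE unitrMl ?unitrV.
have gV : g^-1 = ka k * k^-1 by rewrite gE invrM ?unitrV // invrK.
have fE z : ka' (st' z) = g * ka (st z) * g^-1.
  by rewrite /ka' /st' !(wh_ka_mul wh) kkV gV gE !mulrA.
have gst : g * ka (st g) = 1.
  rewrite gE stM (invol_inv stK stM) // kst k_star (wh_ka_mul wh)
    (kaV wh kku).2 kak.
  by rewrite !mulrA mulrVK // mulrV.
have [sgu sgV] := (invol_unit stK stM gu, invol_inv stK stM gu).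
have [kgu kgV] := kaV wh sgu.
rewrite !fE !stM !(wh_ka_mul wh) (wh_ka_st wh) sgV kgV !mulrA gst mul1r.
have -> : ka (st g) = g^-1 by apply: (mulrI gu); rewrite gst mulrV.
by rewrite invrK mulrK.
Qed.

Lemma deformed_D_star (stt' : tensor A A -> tensor A A) x :
  (forall s t, stt' (s + t) = stt' s + stt' t) ->
  (forall a b, stt' (a ⊗ b) = st' a ⊗ st' b) ->
  D (st' x) * (1 ⊗ k^-1) = stt' (D x * (1 ⊗ k^-1)).
Proof.
move=> sD sE; have /(targetP D)[kl kr] := kT.
have /(targetP D)[vl vr] := target_inv wh kT ku.
have sttE t : stt' (t * (1 ⊗ k^-1)) = (k ⊗ 1) * stt t * (k^-1 ⊗ k^-1).
  elim/tens_ind: t => [s t IHs IHt|a b].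
    by rewrite mulrDl sD (wh_sttD wh) mulrDr mulrDl IHs IHt.
  rewrite tens_mul mulr1 sE (wh_sttE wh) !tens_mul mul1r; congr (_ ⊗ _).
  by rewrite /st' stM kV_star mulrA mulrV // mul1r.
rewrite sttE -(wh_D_st wh) /st' !(wh_D_mul wh) kr vl !mulrA.
rewrite -(mulrA (k ⊗ 1)) (D1l wh) -(mulrA (k ⊗ 1)) (D1r wh).
by rewrite -!mulrA tens_mul mulr1 mul1r.
Qed.

Lemma deformed_ep_ge0 x : 0 <= ep (st' x * x * k).
Proof.
have su : st y \is a GRing.unit by rewrite invol_unit.
have -> : st' x * x * k = st ((st y)^-1 * x * k) * ((st y)^-1 * x * k).
  rewrite !stM (invol_inv stK stM) // stK k_star /st' [X in _ * X^-1]kE invrM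
    //.
  by rewrite !mulrA.
exact: wh_ep_ge0 wh _.
Qed.

Let T := cartan_target D.
Let S := cartan_source D.

Let kVT : k^-1 \in T. Proof. exact: target_inv wh _ kT ku. Qed.
Let kS s : s \in S -> GRing.comm k s.
Proof. exact: target_source_comm wh _ _ kT. Qed.

(** [kappa(k)] is in the source algebra, hence drops out. *)
Lemma deformed_antipode_sq x : x \in T -> ka' (ka' x) = k * ka (ka x) * k^-1.
Proof.
move=> xT; have kkxT : ka (ka x) \in T
  by rewrite (ka_source wh) ?(ka_target wh).
have kVS : ka k^-1 \in S by rewrite (ka_target wh).
have -> : ka' (ka' x) = k * (ka k^-1 * ka (ka x) * ka k) * k^-1.
  by rewrite /ka' !(wh_ka_mul wh) !mulrA.
rewrite -(target_source_comm wh kkxT kVS) -(mulrA _ (ka k^-1)) -(wh_ka_mul wh).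
by rewrite mulrV // (ka1 wh) mulr1.
Qed.

Lemma deformed_antipode_sq_source x : x \in T ->
  ka' (ka' (ka x)) = ka (ka' (ka' x)).
Proof.
move=> xT; rewrite (deformed_antipode_sq xT).
have kxS : ka x \in S by rewrite (ka_target wh).
have k3S : ka (k * ka (ka x) * k^-1) \in S.
  by rewrite (ka_target wh) // !(targetM wh) // (ka_source wh).
transitivity (k * ka (k * ka (ka x) * k^-1) * k^-1); first by [].
by rewrite kS // mulrK.
Qed.

Lemma deformed_target x :
  (D x * (1 ⊗ k^-1) = D 1 * (1 ⊗ k^-1) * (x ⊗ 1) /\
   D x * (1 ⊗ k^-1) = (x ⊗ 1) * (D 1 * (1 ⊗ k^-1))) <-> x \in T.
Proof.
have kk : (1 ⊗ k^-1) * (1 ⊗ k) = 1 :> tensor A A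
  by rewrite tens_mul mulVr ?mulr1.
have xk : (1 ⊗ k^-1) * (x ⊗ 1) = (x ⊗ 1) * (1 ⊗ k^-1) :> tensor A A.
  by rewrite !tens_mul !mulr1 !mul1r.
rewrite -(mulrA (D 1)) xk !mulrA; split.
  move=> [/(congr1 (fun t => t * (1 ⊗ k))) e1 /(congr1 (fun t => t * (1 ⊗ k)))
    e2].
  by apply/(targetP D); move: e1 e2; rewrite -!mulrA kk !mulr1.
by move=> /(targetP D)[<- <-].
Qed.

Lemma deformed_source s : s \in S ->
  D s * (1 ⊗ k^-1) = D 1 * (1 ⊗ k^-1) * (1 ⊗ s) /\
  D s * (1 ⊗ k^-1) = (1 ⊗ s) * (D 1 * (1 ⊗ k^-1)).
Proof.
move=> sS; have sk : (1 ⊗ k^-1) * (1 ⊗ s) = (1 ⊗ s) * (1 ⊗ k^-1) :> tensor A A.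
  rewrite !tens_mul; congr (_ ⊗ _).
  by apply/commr_sym/commrV/commr_sym/kS.
by case/(sourceP D): sS => e1 e2; rewrite -(mulrA (D 1)) sk !mulrA -e1 -e2.
Qed.

Lemma contraction_kunit z : contraction ka z (D 1)
  = contraction idfun z (kunit D ka).
Proof.
have idl : linear (@idfun A) by [].
have kal : linear ka by move=> c a b; rewrite linearP.
rewrite /kunit; elim/tens_ind: (D 1) => [s t IHs IHt|a b].
  by rewrite tensor_mapD !contractionD IHs IHt.
by rewrite tensor_mapE (contractionE _ _ _ idl) (contractionE _ _ _ kal).
Qed.

End DeformedStar.

(** * Deformations of quantum groupoids *)

Lemma tensor_map_conjD (R : realType) (A B : falgType R[i]) (f : A -> A)
    (g : B -> B) (s t : tensor A B) :
  tensor_map_conj f g (s + t) = tensor_map_conj f g s + tensor_map_conj f g t.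
Proof.
rewrite /tensor_map_conj -big_split; apply: eq_bigr => i _ /=.
rewrite -big_split; apply: eq_bigr => j _ /=.
by rewrite /tcoef !mxE rmorphD scalerDl.
Qed.

Section Assembly.
Context (R : realType) (A : falgType R[i]).
Variables (st : A -> A) (D : {linear A -> tensor A A}) (ka : {linear A -> A}).
Variable ep : {scalar A}.
Let G := GroupoidData st D ka ep.
Hypothesis hG : is_quantum_groupoid G.

Lemma groupoid_weak_hopf : star_weak_hopf st (tensor_map_conj st st) D ka ep.
Proof.
have [[[st_conj stK stM] _] [_ DM Dst DA] [_ kst kM kD kmul] [_ ege eid emul]]
  := hG.
split.
- exact: st_conj.
- exact: stK.
- exact: stM.
- exact: tensor_map_conjD.
- by move=> a b; apply: tensor_map_conjE.
- exact: DM.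
- exact: Dst.
- exact: DA.
- exact: kst.
- exact: kM.
- exact: kD.
- exact: kmul.
- exact: ege.
- by move=> x; case: (eid x).
- by move=> x; case: (eid x).
- exact: emul.
Qed.

Let wh := groupoid_weak_hopf.

Section Deformed.
Variables k y : A.
Hypotheses (kT : k \in cartan_target D) (kE : k = st y * y).
Hypotheses (yu : y \is a GRing.unit) (kak : ka (ka k) = k).
Hypothesis k1 : contraction idfun k^-1 (kunit D ka) = 1.

Let ku : k \is a GRing.unit.
Proof. by rewrite kE unitrMl // (invol_unit (wh_stK wh) (wh_st_mul wh)). Qed.

Lemma deformation_cstar : is_cstar_algebra (star (deformation G k)).
Proof.
have [[_ [N [N0 ND NZ NM NC]]] _ _ _] := hG.
split; first split.
- exact: (deformed_st_conj wh k).
- exact: (deformed_stK wh kE yu).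
- exact: (deformed_st_mul wh kE yu).
exists (fun x => N (untwist st y x)); split=> [x|a b|c x|a b|x].
- by split=> [|/(proj2 (N0 _))/(untwist_inj wh yu)];
  first case: (N0 (untwist st y x)).
- by rewrite /untwist mulrDr mulrDl ND.
- by rewrite /untwist -scalerAr -scalerAl NZ.
- by rewrite (untwistM wh yu) NM.
- by rewrite (untwistM wh yu) (untwist_star wh kE yu) NC.
Qed.

Lemma deformation_quantum_groupoid : is_quantum_groupoid (deformation G k).
Proof.
have /(targetP D)[kl kr] := kT.
have k1' : contraction ka k^-1 (D 1) = 1 by rewrite contraction_kunit.
have legs i := source_antipode wh (unit_slice_source wh i).
have DM := wh_D_mul wh; have DA := wh_D_coassoc wh; have kM := wh_ka_mul wh.
have anti := wh_antipode wh.
split; first exact: deformation_cstar.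
- split.
  + exact: deformed_D_linear.
  + exact: (deformed_D_mul DM legs k1').
  + move=> x; apply: (deformed_D_star wh kT kE yu).
      exact: tensor_map_conjD.
    by move=> a b; apply: tensor_map_conjE; exact: (deformed_st_conj wh k).
  + exact: (deformed_coassoc DM DA ku kl).
- split.
  + exact: deformed_ka_linear.
  + exact: (deformed_antipode_star wh kE yu kak).
  + exact: (deformed_ka_mul kM ku).
  + exact: (deformed_ka_D DM kM (wh_ka_D wh) anti ku kl kr k1').
  + exact: (deformed_antipode DM kM anti ku kl kr k1').
- split.
  + exact: deformed_ep_scalar.
  + exact: (deformed_ep_ge0 wh kE yu).
  + move=> x; split; first exact: (deformed_counitl DM (wh_ep_idl wh) ku kl).
    exact: (deformed_counitr (wh_ep_idr wh) ku).
  + exact: (deformed_counit2 (wh_ep_mul wh) ku kl kr).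
Qed.

End Deformed.

End Assembly.

(** * The family of deformations *)

Lemma cartan_pairP (F : fieldType) (A : falgType F) (D : A -> tensor A A)
    (l r : A -> tensor A A) x :
  reflect (D x = D 1 * l x /\ D x = r x * D 1)
          ((D x == D 1 * l x) && (D x == r x * D 1)).
Proof. by apply: (iffP andP) => -[/eqP ? /eqP ?]. Qed.

Lemma morphism_target (F : fieldType) (A B : falgType F) (phi : {linear A -> B})
    (DA : A -> tensor A A) (DB : B -> tensor B B) x :
  phi 1 = 1 -> (forall a b, phi (a * b) = phi a * phi b) ->
  (forall a, tensor_map phi phi (DA a) = DB (phi a)) ->
  (DA x == DA 1 * (x ⊗ 1)) && (DA x == (x ⊗ 1) * DA 1) ->
  (DB (phi x) == DB 1 * (phi x ⊗ 1)) && (DB (phi x) == (phi x ⊗ 1) * DB 1).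
Proof.
move=> p1 pM pD /andP[/eqP l /eqP r].
rewrite -(pD x) -p1 -(pD 1) -tensor_mapE; apply/andP; split; apply/eqP.
  by rewrite -(tensor_map_mul pM pM) -l.
by rewrite -(tensor_map_mul pM pM) -r.
Qed.

(** A countable set has Lebesgue measure zero. *)
Lemma uncountable_positive (R : realType) :
  ~ countable [set r : R | 0 < r]%classic.
Proof.
move=> c; have c01 : countable (`]0, 1[%classic : set R).
  apply: sub_countable c; apply: subset_card_le => x /=.
  by rewrite in_itv /= => /andP[].
have := countable_lebesgue_measure0 c01.
rewrite lebesgue_measure_itv /= lte_fin ltr01 oppr0 adde0.
by move=> /eqP; rewrite onee_eq0.
Qed.

Lemma groupoid_iso_refl (R : realType) (A : falgType R[i])
  (H : groupoid_data A) :
  groupoid_iso H H.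
Proof.
exists id; split; [split | | | |].
- by [].
- by exists id.
- by [].
- by [].
- by [].
- by move=> x; rewrite /tensor_map tlift_id.
- by [].
- by [].
Qed.

(** What is retained of the deformation by [k]: its squared antipode acts on the
    target algebra as conjugation by a dilation, and the antipode of [G] carries
    this to the source algebra. *)
Definition dilating (R : realType) (A : falgType R[i]) (G : groupoid_data A)
    (p : A) (r : R[i]) (k : A) (H := deformation G k) :=
  [/\ admissible G k, is_quantum_groupoid H,
      dilation r p \is a GRing.unit, target H =i target G &
      {in target G, forall x, [/\
        kappa H (kappa H x) = (dilation r p)^-1 * x * dilation r p,
        kappa G x \in source H &
        kappa H (kappa H (kappa G x)) = kappa G (kappa H (kappa H x))]}].

(** Isomorphisms carry target algebras to target algebras and squared antipodes
    to squared antipodes; on the target algebra [1 + r] is the only eigenvalue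
    above [1] of the latter. *)
Lemma iso_parameter (R : realType) (A : falgType R[i])
    (G : groupoid_data A) (k k' p x0 : A) (r r' : R[i]) :
  p * p = p -> 0 < r -> 0 < r' -> dilating G p r k -> dilating G p r' k' ->
  x0 \in target G -> x0 != 0 -> p * x0 = 0 -> x0 * p = x0 ->
  groupoid_iso (deformation G k) (deformation G k') -> r = r'.
Proof.
set H := deformation G k; set K := deformation G k'.
move=> pp r0 r'0 [_ _ ru HT Hk] [_ _ r'u KT Kk] xT x0n px xp.
case=> f [[fl fb f1 fM] _ fD fk _].
pose phi : {linear A -> A} := HB.pack f (GRing.isLinear.Build _ _ _ _ f fl).
have fxT : f x0 \in target G.
  rewrite -KT; apply: (@morphism_target _ _ _ phi (Delta H) (Delta K) x0 f1 fM
    fD).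
  by move: xT; rewrite -HT.
have fx0 : f x0 != 0.
  by apply: contra x0n => /eqP fx; apply/eqP/(bij_inj fb);
    rewrite fx -[f 0]/(phi 0) linear0.
apply: (dilation_eigenvalue pp r0 r'0 fx0).
have [e _ _] := Hk _ xT; rewrite dilation_eigenvector // in e.
have [e' _ _] := Kk _ fxT.
rewrite -!fk e -[f (_ *: _)]/(phi (_ *: _)) linearZ /= in e'.
by rewrite scalerAr e' !mulrA mulrV // mul1r.
Qed.

Section Family.
Context (R : realType) (A : falgType R[i]).
Variables (st : A -> A) (D : {linear A -> tensor A A}) (ka : {linear A -> A}).
Variable ep : {scalar A}.
Let G := GroupoidData st D ka ep.
Hypothesis hG : is_quantum_groupoid G.
Let wh := groupoid_weak_hopf hG.
Let C : numClosedFieldType := R[i].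

Lemma deforming_family : ~ abelian_subalg (target G) ->
  exists (p x0 : A) (K : R -> A),
  [/\ p * p = p, [/\ x0 \in target G, x0 != 0, p * x0 = 0 & x0 * p = x0] &
    forall r, 0 < r -> dilating G p r%:C%C (K r)].
Proof.
move=> nab; have [X [XT kX X1]] := kunit_orthonormal wh.
have [p [y [pT pst pp pq [yT py]]]] := noncentral_projection wh XT nab.
have [x0 x0P] : exists x0, [/\ x0 \in target G, x0 != 0, p * x0 = 0 & x0 * p
  = x0].
  exact: (offdiagonal_corner wh pT pst pp yT py).
have : forall r : R, exists k, 0 < r -> dilating G p r%:C%C k.
  move=> r; have [r0|] := boolP (0 < r); last by exists 0.
  have rC0 : 0 < (r%:C%C : C) by rewrite ltcR.
  have [k [z [kT [kE zu] [kak kq] k1 kconj]]] :=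
    deforming_element wh XT kX X1 rC0 pT pst pp pq.
  have ku : k \is a GRing.unit.
    by rewrite kE unitrMl // (invol_unit (wh_stK wh) (wh_st_mul wh)).
  exists k => _.
  have casimir e : is_matrix_units G (target G) e ->
      kunit D ka = \sum_g \sum_i \sum_j
        (bsize e g)%:R^-1 *: ((munit e g i j * canonical_element st X) ⊗ munit
          e g j i).
    case=> e_pos eT e_mul e_orth [e_one e_span].
    have eT' g i j : munit e g i j \in target G by case: (eT g i j).
    exact: (canonical_casimir wh XT kX e_pos eT' e_mul e_orth e_one e_span).
  split.
  - split=> //; first by exists z.
    exists (canonical_element st X).
      split.
      + exact: (canonical_target wh XT).
      + have [c [_ cu _ <- _]] := canonical_root wh XT X1.
        by rewrite unitrMl.
      + by move=> e /casimir; apply: (unit_casimir wh).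
    move=> e /casimir eE; have := contraction_casimir eE k^-1; rewrite k1 => ->.
    have qk : k^-1 * canonical_element st X = canonical_element st X * k^-1.
      by apply/commr_sym/commrV/commr_sym.
    by rewrite -qk.
  - exact: (deformation_quantum_groupoid hG kT kE zu kak k1).
  - exact: (dilation_unit rC0 pp).
  - move=> x; have [h1 h2] := deformed_target wh kE zu x.
    pose l a : tensor A A := a ⊗ 1.
    apply/idP/idP => [/(cartan_pairP (Delta (deformation G k)) l l)|xT].
      exact: h1.
    exact/(cartan_pairP (Delta (deformation G k)) l l)/h2.
  - move=> x xT; split.
    + rewrite -kconj //; exact: (deformed_antipode_sq wh kT kE zu xT).
    + have kS : ka x \in source G := ka_target wh xT.
      pose l a : tensor A A := 1 ⊗ a.
      apply/(cartan_pairP (Delta (deformation G k)) l l).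
      exact: (deformed_source wh kT kS).
    + exact: (deformed_antipode_sq_source wh kT kE zu xT).
move=> /choice[K KP]; exists p, x0, K; split=> // r; exact: KP.
Qed.

End Family.

Theorem corollary2p8 (R : realType) (A : falgType R[i])
    (G : groupoid_data A) (hG : is_quantum_groupoid G)
    (hnab : ~ abelian_subalg (target G) /\ ~ abelian_subalg (source G)) :
  (exists k : A,
     [/\ admissible G k,
         is_quantum_groupoid (deformation G k),
         exists2 x, x \in target (deformation G k) &
           kappa (deformation G k) (kappa (deformation G k) x) <> x &
         exists2 x, x \in source (deformation G k) &
           kappa (deformation G k) (kappa (deformation G k) x) <> x])
  /\
  (exists S : set (groupoid_data A),
     [/\ forall H, S H -> is_quantum_groupoid H,
         forall H K, S H -> S K -> groupoid_iso H K -> H = K &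
         ~ countable S]).
Proof.
case: hnab => hnab _; case: G hG hnab => st D0 ka0 ep0 hG hnab.
have [Dl kal epl] : [/\ linear D0, linear ka0 & scalar ep0].
  by have [_ [Dl _ _ _] [kal _ _ _ _] [epl _ _ _]] := hG.
pose D : {linear A -> tensor A A} :=
  HB.pack D0 (GRing.isLinear.Build _ _ _ _ D0 Dl).
pose ka : {linear A -> A} := HB.pack ka0 (GRing.isLinear.Build _ _ _ _ ka0 kal).
pose ep : {scalar A} := HB.pack ep0 (GRing.isLinear.Build _ _ _ _ ep0 epl).
pose G := GroupoidData st D0 ka0 ep0.
have wh := @groupoid_weak_hopf R A st D ka ep hG.
have [p [x0 [K [pp [xT x0n px xp] KP]]]] :=
  @deforming_family R A st D ka ep hG hnab.
have pos (r : R) : 0 < r -> 0 < r%:C%C :> R[i] by rewrite ltcR.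
split.
  have [adm qg uu KT Kk] := KP 1 ltr01; have [e xS eS] := Kk _ xT.
  have nx : kappa (deformation G (K 1)) (kappa (deformation G (K 1)) x0) <> x0.
    rewrite [LHS]e dilation_eigenvector // -[RHS]scale1r => /eqP.
    rewrite -subr_eq0 -scalerBl addrAC subrr add0r scaler_eq0 (negPf x0n) orbF.
    by rewrite gt_eqF // pos.
  have nx' : kappa (deformation G (K 1)) (kappa (deformation G (K 1)) (ka x0))
    <> ka x0.
    by move=> h; apply/nx/(ka_inj wh); exact: etrans (esym eS) h.
  exists (K 1); split; [exact: adm | exact: qg | | by exists (ka x0)].
  exists x0; [exact: etrans (KT x0) xT | exact: nx].
have par (r r' : R) : 0 < r -> 0 < r' ->
    groupoid_iso (deformation G (K r)) (deformation G (K r')) -> r = r'.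
  move=> r0 r'0 iso; apply: complexI.
  exact: (iso_parameter pp (pos _ r0) (pos _ r'0) (KP _ r0) (KP _ r'0)
    xT x0n px xp iso).
exists (fun H => exists2 r : R, 0 < r & H = deformation G (K r)); split.
- by move=> _ [r r0 ->]; have [_ qg _ _ _] := KP r r0.
- by move=> _ _ [r r0 ->] [r' r'0 ->] /(par _ _ r0 r'0) ->.
move=> /countable_injP[f f_inj]; apply: (@uncountable_positive R).
apply/countable_injP; exists (fun r : R => f (deformation G (K r))).
move=> r r'; rewrite !inE => r0 r'0 /f_inj; rewrite !inE => e.
have {}e : deformation G (K r) = deformation G (K r').
  by apply: e; [exists r | exists r'].
by apply: (par _ _ r0 r'0); rewrite e; apply: groupoid_iso_refl.
Qed.
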